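(* There are constants $b$ and $q_0$ such that the following holds for all $q\ge q_0$. Let $G=\mathrm{SL}(2,q)$, let $k\ge 2$ and $t\ge1$ be integers, and let $P:G^{k\times t}\to\{0,1\}$ be computed by a deterministic $k$-party number-on-forehead protocol with $c$ bits of communication. For $g\in G$ let $p_g$ be the probability that $P$ outputs $1$ on a uniformly random input $(a_{i,j})_{i\le k,j\le t}\in G^{k\times t}$ conditioned on $\prod_{j=1}^t a_{1j}a_{2j}\cdots a_{kj}=g$ (product taken in column order: $a_{11}\cdots a_{k1}a_{12}\cdots a_{k2}\cdots a_{1t}\cdots a_{kt}$). Then for any $g,h\in G$: (1) if $t\ge b^{2^k}$, then $|p_g-p_h|\le 2^c|G|^{-t/b^{2^k}}$; (2) if $k=2$ and $t\ge2$, then $|p_g-p_h|\le 2^c|G|^{-t/b}$.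
   Context: In the $k$-party number-on-forehead model, the input is a $k\times t$ matrix of elements of $G$; party $i$ sees every entry except those in row $i$. The parties alternately write bits on a shared blackboard according to a fixed protocol, each bit being a function of the blackboard so far and the entries the writing party sees; the output is determined by the blackboard; the communication is the total number of bits written in the worst case. $\mathrm{SL}(2,q)$ is the group of $2\times2$ determinant-one matrices over $\mathbb F_q$. *)

(* Defs.v *)
From Stdlib Require Import Reals.
From HB Require Import structures.
From mathcomp Require Import all_boot all_order all_algebra all_fingroup all_field.

Set Implicit Arguments.
Unset Strict Implicit.
Unset Printing Implicit Defensive.

Import GRing.Theory.

Definition SL2 (F : finFieldType) : predArgType :=
  {A : 'M[F]_2 | (\det A == 1)%R}.

Definition NOFInput (F : finFieldType) (k t : nat) := 'M[SL2 F]_(k, t).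

Definition col_prod (F : finFieldType) (k t : nat) (x : NOFInput F k t)
  : 'M[F]_2 :=
  (\prod_(j < t) \prod_(i < k) val (x i j))%R.

(* Deterministic k-party protocol tree: at each internal node, party i writes
   the bit f x; the subtree is selected by that bit (the path = blackboard). *)
Inductive protocol (X : Type) (k t : nat) : Type :=
| PLeaf of bool
| PNode (i : 'I_k) (f : 'M[X]_(k, t) -> bool) (l r : protocol X k t).

Arguments PLeaf {X k t}.
Arguments PNode {X k t}.

Fixpoint prot_eval X k t (p : protocol X k t) (x : 'M[X]_(k, t)) : bool :=
  match p with
  | PLeaf b => b
  | PNode _ f l r => if f x then prot_eval r x else prot_eval l x
  end.

Fixpoint prot_cost X k t (p : protocol X k t) : nat :=
  match p with
  | PLeaf _ => 0
  | PNode _ _ l r => (maxn (prot_cost l) (prot_cost r)).+1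
  end.

Fixpoint prot_NOF X k t (p : protocol X k t) : Prop :=
  match p with
  | PLeaf _ => True
  | PNode i f l r =>
      (forall x y : 'M[X]_(k, t),
          (forall (r : 'I_k) (c : 'I_t), r != i -> x r c = y r c) ->
          f x = f y)
      /\ prot_NOF l /\ prot_NOF r
  end.

Definition cond_prob (F : finFieldType) (k t : nat)
  (P : NOFInput F k t -> bool) (g : SL2 F) : R :=
  Rdiv (INR #|[set x : NOFInput F k t | (col_prod x == val g) && P x]|)
       (INR #|[set x : NOFInput F k t | col_prod x == val g]|).

(* Main.v *)
(** A protocol with [c] bits is a disjoint union of at most [2^c] cylinder
    intersections, so it suffices to bound the correlation of one cylinder
    intersection with [x |-> m (prod x)], where [m = |G| (1_g - 1_h)].

    By [k] applications of Cauchy-Schwarz that correlation to the power [2^k] is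
    at most [E prod_e m(x_e)], where [(x_e)_e] in [G^{0,1}^k] is a product of
    [t] independent copies of [(u_1^{e_1} ... u_k^{e_k})_e].  Averaging over one
    copy is a product [A_1 ... A_k], where [A_j] is the projection onto the
    functions invariant under the points of the cube that depend on [e_j] only.
    By induction the product of the first [k - 1] projections is close to the
    projection onto the functions invariant under all points not depending on
    [e_k], and composing the latter with [A_k] leaves almost nothing but the
    mean: this reduces to the fact that for a random [g] in [G] translation by
    a random conjugate of [(g, ..., g)] in [G^M] has norm at most [nu] on
    functions of mean zero.  That in turn follows from the equidistribution of
    commutators, [|G| sum_w Pr([x,y] = w)^2 = sum_chi chi(1)^-2], because every
    nontrivial character of SL(2, q) has degree at least [(q - 1)/2].

    The power [2^k] is too lossy for two parties and small [t]; there all columns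
    but two are fixed and two applications of Cauchy-Schwarz lead directly to the
    operator of norm [nu]. *)

From Stdlib Require Import Reals Lra Lia.

(** * Numerical estimates *)

Local Open Scope R_scope.

Lemma exp_le_compat (x y : R) : x <= y -> exp x <= exp y.
Proof. intros [H| ->]; [left; now apply exp_increasing | right; reflexivity]. Qed.

Lemma exp_pow (x : R) (n : nat) : exp x ^ n = exp (INR n * x).
Proof.
induction n as [|n IHn]; [now rewrite Rmult_0_l, exp_0|].
rewrite S_INR; simpl; rewrite IHn, <- exp_plus; f_equal; ring.
Qed.

Lemma pow2_INR_gt (k : nat) : INR k + 1 <= 2 ^ k.
Proof.
induction k as [|k IHk]; [simpl; lra|].
rewrite S_INR; simpl; assert (H := pos_INR k); lra.
Qed.

(** In [contraction_le], one factor [2 ^ k] comes from the exponent and the other from the gap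
    [2 ^ -k], while [160 = 5 * 32] combines the exponent constant with [ln L <= 32 k]. *)
Lemma tower_ge (k m : nat) : m = Nat.pow 2 k -> 160 * INR k * 4 ^ k <= 65536 ^ m.
Proof.
intros ->.
assert (Hm : (k + 1 <= Nat.pow 2 k)%nat).
{ clear; induction k as [|k IHk]; simpl; lia. }
apply Rle_trans with (65536 ^ (k + 1)); [|apply Rle_pow; [lra|exact Hm]].
apply Rle_trans with (65536 * 8 ^ k).
- replace (8 ^ k) with (2 ^ k * 4 ^ k) by (rewrite <- Rpow_mult_distr; f_equal; lra).
  assert (H4 : 0 < 4 ^ k) by (apply pow_lt; lra).
  assert (Hk := pow2_INR_gt k). assert (H0 := pos_INR k).
  rewrite <- Rmult_assoc; apply Rmult_le_compat_r; [lra|].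
  set (y := 2 ^ k) in *; lra.
- rewrite Nat.add_1_r; cbn [pow]; apply Rmult_le_compat_l; [lra|].
  apply pow_incr; split; lra.
Qed.

Lemma bernoulli_sub (nu : R) (k : nat) :
  0 <= nu <= 1 -> 1 - INR k * nu <= (1 - nu) ^ k.
Proof.
intros Hnu; induction k as [|k IHk]; [simpl; lra|].
rewrite S_INR; simpl.
assert (0 <= (1 - nu) ^ k <= 1).
{ split; [apply pow_le; lra|]. apply Rle_trans with (1 ^ k);
    [apply pow_incr; split; lra | rewrite pow1; lra]. }
assert (Hk := pos_INR k). nra.
Qed.

(* Either [k nu <= L^(-1/32)], or [k] exceeds [L^(1/32)] and the trivial gap
   [2^-k] is already far larger than [ln L / b^(2^k)]. *)
Lemma contraction_le (L : R) (k m : nat) :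
  2 ^ 64 <= L -> (1 <= k)%nat -> m = Nat.pow 2 k ->
  1 - (1 - Rpower L (- (1 / 16))) ^ (k - 1) <= exp (- (5 * 2 ^ k * ln L / 65536 ^ m)).
Proof.
intros HL Hk Hm.
set (l := ln L); set (nu := Rpower L (- (1 / 16))).
assert (Hln : l >= 64 * ln 2).
{ replace (64 * ln 2) with (ln (2 ^ 64)) by (rewrite ln_pow by lra; simpl; ring).
  apply Rle_ge; destruct HL as [HL|<-]; [left; apply ln_increasing; [apply pow_lt; lra|exact HL]|right; reflexivity]. }
assert (Hln2 := ln_lt_2).
assert (Hnu : 0 < nu <= 1 / 2).
{ unfold nu, Rpower; fold l; split; [apply exp_pos|].
  replace (1 / 2) with (exp (- ln 2)); [apply exp_le_compat; lra|].
  rewrite exp_Ropp, exp_ln by lra; lra. }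
assert (HB := tower_ge k m Hm).
set (B := 65536 ^ m) in *.
assert (Hk1 : 1 <= INR k) by (apply (le_INR 1); exact Hk).
assert (H2k : 0 < 2 ^ k) by (apply pow_lt; lra).
assert (H4 : 4 ^ k = 2 ^ k * 2 ^ k) by (rewrite <- Rpow_mult_distr; f_equal; lra).
assert (H2k1 : 1 <= 2 ^ k) by (apply pow_R1_Rle; lra).
rewrite H4 in HB.
assert (HBpos : 0 < B) by (unfold B; apply pow_lt; lra).
destruct (Rle_lt_dec (INR k * nu) (exp (- (l / 32)))) as [Hsmall|Hbig].
- apply Rle_trans with (exp (- (l / 32))).
  + apply Rle_trans with (INR k * nu); [|exact Hsmall].
    assert (Hb := bernoulli_sub nu (k - 1) ltac:(lra)).
    assert (INR (k - 1) <= INR k) by (apply le_INR; lia).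
    nra.
  + apply exp_le_compat, Ropp_le_contravar.
    apply Rmult_le_reg_r with B; [exact HBpos|].
    unfold Rdiv at 1; rewrite Rmult_assoc, Rinv_l, Rmult_1_r by lra.
    assert (160 * 2 ^ k <= B) by nra. nra.
(* Multiplying [Hbig] by [1 / nu = exp (l / 16)] gives [exp (l / 32) <= k], and the exponential is
   at least [1 + l / 32]. *)
- assert (Hl : l <= 32 * INR k).
  { assert (exp (l / 32) <= INR k).
    { replace (exp (l / 32)) with (exp (- (l / 32)) * exp (l / 16))
        by (rewrite <- exp_plus; f_equal; lra).
      apply Rle_trans with (INR k * nu * exp (l / 16)).
      - apply Rmult_le_compat_r; [left; apply exp_pos|lra].
      - unfold nu, Rpower; fold l; rewrite Rmult_assoc, <- exp_plus.
        replace (- (1 / 16) * l + l / 16) with 0 by lra.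
        rewrite exp_0; lra. }
    assert (H1 := exp_ineq1_le (l / 32)). lra. }
  apply Rle_trans with (1 - / 2 ^ k).
  + assert ((1 / 2) ^ (k - 1) <= (1 - nu) ^ (k - 1)) by (apply pow_incr; split; lra).
    assert (/ 2 ^ k <= (1 / 2) ^ (k - 1)).
    { replace (/ 2 ^ k) with ((1 / 2) ^ k)
        by (unfold Rdiv; rewrite Rmult_1_l, pow_inv; reflexivity).
      destruct k as [|k']; [lia|]. simpl; rewrite Nat.sub_0_r.
      assert (0 < (1 / 2) ^ k') by (apply pow_lt; lra). lra. }
    lra.
  + apply Rle_trans with (exp (- / 2 ^ k)).
    * assert (H1 := exp_ineq1_le (- / 2 ^ k)). lra.
    * apply exp_le_compat, Ropp_le_contravar.
      apply Rmult_le_reg_r with B; [exact HBpos|].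
      unfold Rdiv at 1; rewrite Rmult_assoc, Rinv_l, Rmult_1_r by lra.
      apply Rmult_le_reg_l with (2 ^ k); [exact H2k|].
      replace (2 ^ k * (/ 2 ^ k * B)) with B by (field; lra).
      apply Rle_trans with (160 * INR k * (2 ^ k * 2 ^ k)); [|exact HB].
      set (p := 2 ^ k) in *.
      replace (p * (5 * p * l)) with (5 * l * (p * p)) by ring.
      apply Rmult_le_compat_r; nra.
Qed.

Lemma pow_double_sqr_le (L : R) (n : nat) :
  2 <= L -> (2 * L ^ 2) ^ n <= exp (3 * ln L * INR n).
Proof.
intros HL.
replace (3 * ln L * INR n) with (INR n * (INR 3 * ln L)) by (simpl; ring).
rewrite <- exp_pow, <- (exp_pow (ln L)), exp_ln by lra.
apply pow_incr; split; nra.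
Qed.

Lemma INR_pow2 (k m : nat) : m = Nat.pow 2 k -> INR m = 2 ^ k.
Proof. now intros ->; rewrite pow_INR. Qed.

(** In units of [2 ^ k * ln L * (t / B)] the contraction contributes exponent [-5]. The moment
    factor is at most [L ^ (3 m)], which costs at most [+3] because [t >= B]. The remaining [-2] is
    exactly the [2 m]-th power on the right. *)
Lemma box_bound_le (L : R) (k m t : nat) :
  2 ^ 64 <= L -> (1 <= k)%nat -> m = Nat.pow 2 k -> 65536 ^ m <= INR t ->
  (1 - (1 - Rpower L (- (1 / 16))) ^ (k - 1)) ^ t * (2 * L ^ 2) ^ m
    <= Rpower L (- (INR t / 65536 ^ m)) ^ (2 * m).
Proof.
intros HL Hk Hm Ht.
assert (HL2 : 2 <= L) by (apply Rle_trans with (2 ^ 64); lra).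
assert (Hl : 0 <= ln L) by (rewrite <- ln_1; left; apply ln_increasing; lra).
assert (HmR := INR_pow2 k m Hm).
set (B := 65536 ^ m) in *.
assert (HBpos : 0 < B) by (unfold B; apply pow_lt; lra).
assert (H2k : 0 < 2 ^ k) by (apply pow_lt; lra).
assert (Hr0 : 0 <= 1 - (1 - Rpower L (- (1 / 16))) ^ (k - 1)).
{ assert ((1 - Rpower L (- (1 / 16))) ^ (k - 1) <= 1); [|lra].
  apply Rle_trans with (1 ^ (k - 1)); [|rewrite pow1; lra].
  apply pow_incr; unfold Rpower.
  assert (Hp := exp_pos (- (1 / 16) * ln L)).
  assert (exp (- (1 / 16) * ln L) <= exp 0) by (apply exp_le_compat; lra).
  rewrite exp_0 in *; lra. }
apply Rle_trans with (exp (- (5 * 2 ^ k * ln L / B)) ^ t * exp (3 * ln L * INR m)).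
{ apply Rmult_le_compat.
  - apply pow_le, Hr0.
  - apply pow_le; nra.
  - apply pow_incr; split; [exact Hr0|]. now apply contraction_le.
  - now apply pow_double_sqr_le. }
unfold Rpower; rewrite !exp_pow, <- exp_plus; apply exp_le_compat.
rewrite mult_INR, HmR; simpl (INR 2).
assert (HtB : 1 <= INR t / B).
{ apply Rmult_le_reg_r with B; [exact HBpos|].
  unfold Rdiv; rewrite Rmult_assoc, Rinv_l by lra; lra. }
replace (INR t * - (5 * 2 ^ k * ln L / B)) with (- 5 * (2 ^ k * ln L) * (INR t / B))
  by (field; lra).
replace ((1 + 1) * 2 ^ k * (- (INR t / B) * ln L))
  with (- 2 * (2 ^ k * ln L) * (INR t / B)) by (field; lra).
assert (0 <= 2 ^ k * ln L) by nra.
nra.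
Qed.

(** The two-party instance, with [b] in place of [b ^ 4]: the exponent [12] of the moment factor is
    small against [t / 16 >= 32]. *)
Lemma box2_bound_le (L : R) (t : nat) :
  2 <= L -> (512 <= t)%nat ->
  Rpower L (- (1 / 16)) ^ t * (2 * L ^ 2) ^ 4
    <= Rpower L (- (INR t / 65536)) ^ 8.
Proof.
intros HL Ht.
assert (Hl : 0 <= ln L) by (rewrite <- ln_1; left; apply ln_increasing; lra).
assert (HtR : 512 <= INR t) by (replace 512 with (INR 512) by (simpl; lra); now apply le_INR).
apply Rle_trans with (Rpower L (- (1 / 16)) ^ t * exp (3 * ln L * INR 4)).
{ apply Rmult_le_compat_l; [apply pow_le; left; apply exp_pos|].
  now apply pow_double_sqr_le. }
unfold Rpower; rewrite !exp_pow, <- exp_plus; apply exp_le_compat; simpl (INR 4);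
  simpl (INR 8).
nra.
Qed.

(** For [t < 512] the right side is at least [L ^ (-1/64)], so it is enough that [4 <= L ^ (3/64)],
    which [L >= 2 ^ 64] ensures. *)
Lemma two_columns_bound_le (L : R) (t : nat) :
  2 ^ 64 <= L -> (t < 512)%nat ->
  4 * Rpower L (- (1 / 16)) <= Rpower L (- (INR t / 65536)) ^ 2.
Proof.
intros HL Ht.
assert (Hln : ln L >= 64 * ln 2).
{ replace (64 * ln 2) with (ln (2 ^ 64)) by (rewrite ln_pow by lra; simpl; ring).
  apply Rle_ge; destruct HL as [HL|<-]; [left; apply ln_increasing; [apply pow_lt; lra|exact HL]|right; reflexivity]. }
assert (Hln2 := ln_lt_2).
assert (HtR : INR t <= 512) by (replace 512 with (INR 512) by (simpl; lra); apply le_INR; lia).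
assert (Ht0 := pos_INR t).
replace 4 with (exp (2 * ln 2)).
2:{ replace (2 * ln 2) with (ln 2 + ln 2) by ring; rewrite exp_plus, exp_ln by lra; lra. }
unfold Rpower; rewrite exp_pow, <- exp_plus; apply exp_le_compat; simpl (INR 2).
nra.
Qed.

(** This justifies the exponent [1/16]: with [L <= q ^ 3], the ratio [16 L / (q - 1) ^ 4] is of
    order at most [1 / q], whereas [nu ^ 4 = L ^ (-1/4)] is at least [q ^ (-3/4)]. *)
Lemma degree_bound_le (L q : R) :
  2 ^ 64 <= q -> 1 <= L <= q ^ 3 ->
  16 * L <= Rpower L (- (1 / 16)) ^ 4 * (q - 1) ^ 4.
Proof.
intros Hq HL.
assert (Hq2 : 2 <= q) by (apply Rle_trans with (2 ^ 64); lra).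
assert (Hln : ln q >= 64 * ln 2).
{ replace (64 * ln 2) with (ln (2 ^ 64)) by (rewrite ln_pow by lra; simpl; ring).
  apply Rle_ge; destruct Hq as [Hq|<-]; [left; apply ln_increasing; [apply pow_lt; lra|exact Hq]|right; reflexivity]. }
assert (Hln2 := ln_lt_2).
assert (HlnL : ln L <= 3 * ln q).
{ replace (3 * ln q) with (ln (q ^ 3)) by (rewrite ln_pow by lra; simpl; ring).
  destruct HL as [H1 [H2| ->]]; [left; apply ln_increasing; lra|right; reflexivity]. }
apply Rle_trans with (Rpower L (- (1 / 16)) ^ 4 * (q / 2) ^ 4).
2:{ apply Rmult_le_compat_l; [apply pow_le; left; apply exp_pos|].
    apply pow_incr; split; lra. }
replace (q / 2) with (exp (ln q - ln 2)).
2:{ unfold Rminus; rewrite exp_plus, exp_Ropp, !exp_ln by lra; reflexivity. }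
replace (16 * L) with (exp (4 * ln 2 + ln L)).
2:{ replace 4 with (INR 4) by (simpl; lra).
    rewrite exp_plus, <- exp_pow, !exp_ln by lra; simpl; ring. }
unfold Rpower; rewrite !exp_pow, <- !exp_plus; apply exp_le_compat; simpl (INR 4).
lra.
Qed.

Lemma one_le_of_pow64_le (x : R) : 2 ^ 64 <= x -> 1 <= x.
Proof. intros H; apply Rle_trans with (2 ^ 64); [lra|exact H]. Qed.

Lemma Rpower_neg_le1 (L a : R) : 1 <= L -> 0 <= a -> 0 <= Rpower L (- a) <= 1.
Proof.
intros HL Ha; split; [left; apply exp_pos|].
rewrite <- (Rpower_O L) by lra; apply Rle_Rpower; lra.
Qed.

Lemma two_le_of_pow64_le (x : R) : 2 ^ 64 <= x -> 2 <= x.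
Proof. intros H; apply Rle_trans with (2 ^ 64); [lra|exact H]. Qed.

Local Close Scope R_scope.

Require Import Defs.
From HB Require Import structures.
From mathcomp Require Import all_boot all_order all_algebra all_fingroup all_field.
From mathcomp Require Import all_solvable all_character.
From mathcomp Require Import Rstruct.
From mathcomp Require Import ring lra.

Set Implicit Arguments.
Unset Strict Implicit.
Unset Printing Implicit Defensive.

Import Order.TTheory GRing.Theory Num.Theory.

Delimit Scope R_scope with coqR.
Local Open Scope ring_scope.

(** * Averages over finite types *)

(** Locked so that nested averages stay opaque during rewriting. Over an empty type the value is
    [0], by the convention for division by zero. *)
HB.lock Definition avg (R : realFieldType) (X : finType) (f : X -> R) : R :=
  (\sum_x f x) / #|X|%:R.

Reserved Notation "\E_ x F"
  (at level 41, x name, F at level 41, right associativity).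
Reserved Notation "\E_ ( x : T ) F"
  (at level 41, x name, F at level 41, right associativity).
Notation "\E_ x F" := (avg (fun x => F)) : ring_scope.
Notation "\E_ ( x : T ) F" := (avg (fun x : T => F)) (only parsing) : ring_scope.

Lemma avgE (R : realFieldType) (X : finType) (f : X -> R) :
  avg f = (\sum_x f x) / #|X|%:R.
Proof. by rewrite avg.unlock. Qed.

Section Avg.
Variable R : realFieldType.
Implicit Types X Y : finType.

Lemma eq_avg X (f f' : X -> R) : f =1 f' -> avg f = avg f'.
Proof. by move=> e; rewrite !avgE (eq_bigr f'). Qed.

Lemma avgD X (f f' : X -> R) : \E_ x (f x + f' x) = avg f + avg f'.
Proof. by rewrite !avgE big_split mulrDl. Qed.

Lemma avgN X (f : X -> R) : \E_ x (- f x) = - avg f.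
Proof. by rewrite !avgE sumrN mulNr. Qed.

Lemma avgB X (f f' : X -> R) : \E_ x (f x - f' x) = avg f - avg f'.
Proof. by rewrite avgD avgN. Qed.

Lemma avgZl X c (f : X -> R) : \E_ x (c * f x) = c * avg f.
Proof. by rewrite !avgE -mulr_sumr mulrA. Qed.

Lemma avgZr X c (f : X -> R) : \E_ x (f x * c) = avg f * c.
Proof. by rewrite !avgE -mulr_suml mulrAC. Qed.

Lemma avg_const X (x : X) (c : R) : \E_ (y : X) c = c.
Proof.
rewrite !avgE sumr_const -[X in X / _]mulr_natr mulfK //.
by rewrite pnatr_eq0 -lt0n; apply/card_gt0P; exists x.
Qed.

Lemma avg0 X : \E_ (y : X) 0 = 0 :> R.
Proof. by rewrite !avgE big1 ?mul0r. Qed.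

Lemma avg_ge0 X (f : X -> R) : (forall x, 0 <= f x) -> 0 <= avg f.
Proof. by move=> f_ge0; rewrite avgE divr_ge0 ?sumr_ge0 ?ler0n. Qed.

Lemma le_avg X (f f' : X -> R) : (forall x, f x <= f' x) -> avg f <= avg f'.
Proof. by move=> le_f; rewrite !avgE ler_wpM2r ?invr_ge0 ?ler0n ?ler_sum. Qed.

Lemma avg_exchange X Y (f : X -> Y -> R) :
  \E_ x \E_ y f x y = \E_ y \E_ x f x y.
Proof. by rewrite avg.unlock -!mulr_suml exchange_big /= mulrAC. Qed.

Lemma avg_pair X Y (f : X * Y -> R) : avg f = \E_ x \E_ y f (x, y).
Proof.
rewrite avg.unlock -!mulr_suml pair_big /= card_prod mulnC natrM invfM mulrA.
by congr (_ / _ / _); apply: eq_bigr => -[].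
Qed.

Lemma avg_bij X Y (h : X -> Y) (f : Y -> R) :
  bijective h -> avg f = \E_ x f (h x).
Proof.
move=> h_bij; rewrite !avgE (bij_eq_card h_bij); congr (_ / _).
by rewrite (reindex h) //; apply: onW_bij.
Qed.

(** Lagrange's identity: the nonnegative double average of [(f x * h y - f y * h x) ^+ 2] equals
    [2 * (A * C - B ^+ 2)]. *)
Lemma avg_CauchySchwarz X (f h : X -> R) :
  (\E_ x (f x * h x)) ^+ 2 <= (\E_ x f x ^+ 2) * \E_ x h x ^+ 2.
Proof.
set A := \E_ x f x ^+ 2; set B := avg _; set C := \E_ x h x ^+ 2.
suff : 0 <= \E_ x \E_ y (f x * h y - f y * h x) ^+ 2.
  suff -> : \E_ x \E_ y (f x * h y - f y * h x) ^+ 2 = 2 * (A * C - B ^+ 2).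
    by rewrite pmulr_rge0 ?ltr0n // subr_ge0.
  transitivity (\E_ x \E_ y (f x ^+ 2 * h y ^+ 2 + h x ^+ 2 * f y ^+ 2
                   + - 2 * (f x * h x) * (f y * h y))).
    by apply: eq_avg => x; apply: eq_avg => y; ring.
  transitivity (\E_ x (f x ^+ 2 * C + h x ^+ 2 * A + - 2 * (f x * h x) * B)).
    by apply: eq_avg => x; rewrite !avgD !avgZl.
  rewrite !avgD !avgZr.
  rewrite avgZl -/A -/B -/C; ring.
by apply: avg_ge0 => x; apply: avg_ge0 => y; apply: sqr_ge0.
Qed.

Lemma sqr_avg_le X (f : X -> R) : (avg f) ^+ 2 <= \E_ x f x ^+ 2.
Proof.
case: (pickP (fun _ : X => true)) => [x0 _ | X0].
  have := avg_CauchySchwarz f (fun=> 1); rewrite avg_const // expr1n mulr1.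
  by under eq_avg => x do rewrite mulr1.
by rewrite [in leLHS]avgE big_pred0 // mul0r expr0n avg_ge0 // => x; apply: sqr_ge0.
Qed.

Lemma avg_ffun_cons X n (f : {ffun 'I_n.+1 -> X} -> R) :
  avg f = \E_ x \E_ (y : {ffun 'I_n -> X})
            f [ffun i => oapp y x (unlift ord0 i)].
Proof.
rewrite -[RHS](avg_pair (fun p : X * {ffun 'I_n -> X} =>
   f [ffun i => oapp p.2 p.1 (unlift ord0 i)])).
pose tl (y : {ffun 'I_n.+1 -> X}) := (y ord0, [ffun i => y (lift ord0 i)]).
apply: avg_bij; exists tl => [[x y]|y].
  rewrite /tl ffunE unlift_none; congr pair.
  by apply/ffunP=> i; rewrite !ffunE liftK.
apply/ffunP=> i; rewrite !ffunE /=.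
by case: unliftP => [j|] -> //=; rewrite ffunE.
Qed.

Lemma avg_ffun_pair X Y (I : finType) (f : {ffun I -> X * Y} -> R) :
  avg f = \E_ (x : {ffun I -> X}) \E_ (y : {ffun I -> Y})
            f [ffun i => (x i, y i)].
Proof.
rewrite -[RHS](avg_pair (fun p : {ffun I -> X} * {ffun I -> Y} =>
   f [ffun i => (p.1 i, p.2 i)])).
apply: avg_bij.
exists (fun y : {ffun I -> X * Y} =>
          ([ffun i => (y i).1], [ffun i => (y i).2])) => [[x y]|y].
  by congr pair; apply/ffunP => i; rewrite !ffunE.
by apply/ffunP => i; rewrite !ffunE /= -surjective_pairing.
Qed.

Section Group.
Variable N : finGroupType.
Implicit Type f : N -> R.

Lemma avg_mulr f a : avg f = \E_ x f (x * a)%g.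
Proof. by apply: avg_bij; exists (mulg^~ a^-1)%g => x; rewrite (mulgK, mulgKV). Qed.

Lemma avg_mull f a : avg f = \E_ x f (a * x)%g.
Proof. by apply: avg_bij; exists (mulg a^-1)%g => x; rewrite (mulKg, mulKVg). Qed.

Lemma avg_inv f : avg f = \E_ x f x^-1%g.
Proof. by apply: avg_bij; exists invg => x; rewrite invgK. Qed.

Lemma avg_conj f a : avg f = \E_ x f (x ^ a)%g.
Proof. by apply: avg_bij; exists (conjg^~ a^-1)%g => x; rewrite (conjgK, conjgKV). Qed.

End Group.
End Avg.

(** * Conjugation mixing and almost commuting projections *)

Section Mixing.
Variable R : realFieldType.

Lemma ler_of_sqr (x y : R) : 0 <= y -> x ^+ 2 <= y ^+ 2 -> x <= y.
Proof.
move=> y_ge0; apply: contraTT; rewrite -!ltNge => lt_yx.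
by rewrite ltr_sqr ?nnegrE // ltW ?(le_lt_trans y_ge0).
Qed.

Lemma avg_sqr_addC (X : finType) (x0 : X) (c : R) (f : X -> R) :
  avg f = 0 -> \E_ x (c + f x) ^+ 2 = c ^+ 2 + \E_ x f x ^+ 2.
Proof.
move=> f0; transitivity (\E_ x (c ^+ 2 + 2 * c * f x + f x ^+ 2)).
  by apply: eq_avg => x; ring.
by rewrite !avgD avg_const // avgZl f0 mulr0 addr0.
Qed.

Definition conj_avg (N : finGroupType) (d : N) (phi : N -> R) (z : N) : R :=
  \E_ n phi (z * d ^ n)%g.

(** Here [r] bounds the squared norm, on mean-zero functions, of the operator from functions on [N]
    to functions on [G * N] that sends [phi] to [conj_avg (delta g) phi z]. The average over [g] is
    essential: [g = 1] alone does not contract. *)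
Definition conj_mixing (G N : finGroupType) (delta : G -> N) (r : R) : Prop :=
  forall phi : N -> R, avg phi = 0 ->
  \E_ g \E_ z (conj_avg (delta g) phi z) ^+ 2 <= r * \E_ z phi z ^+ 2.

(** Split [phi] into its average [f0] over the first coordinate and a remainder [f1] with mean zero
    in that coordinate. The operator keeps the two parts orthogonal; [mix2] contracts the first and
    [mix1] the second, so the constant [r] does not deteriorate. *)
Lemma conj_mixing_pair (G N1 N2 : finGroupType) (d1 : G -> N1) (d2 : G -> N2) r :
  conj_mixing d1 r -> conj_mixing d2 r ->
  conj_mixing (fun g => (d1 g, d2 g)) r.
Proof.
move=> mix1 mix2 phi phi0.
pose f0 y := \E_ x phi (x, y); pose f1 y x := phi (x, y) - f0 y.
have f1_0 y : avg (f1 y) = 0.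
  by rewrite avgB avg_const ?subrr //; exact: 1%g.
pose A0 g := conj_avg (d2 g) f0.
pose A1 g y x := \E_ m conj_avg (d1 g) (f1 (y * d2 g ^ m)%g) x.
have A1_0 g y : avg (A1 g y) = 0.
  rewrite [LHS]avg_exchange; transitivity (\E_ (m : N2) 0 : R); last exact: avg0.
  apply: eq_avg => m; rewrite [LHS]avg_exchange.
  transitivity (\E_ (n : N1) 0 : R); last exact: avg0.
  by apply: eq_avg => n; rewrite -avg_mulr f1_0.
have splitA g x y : conj_avg (d1 g, d2 g) phi (x, y) = A0 g y + A1 g y x.
  rewrite /conj_avg avg_pair [LHS]avg_exchange -avgD.
  apply: eq_avg => m; rewrite /conj_avg.
  transitivity (\E_ n (f0 (y * d2 g ^ m)%g
                   + f1 (y * d2 g ^ m)%g (x * d1 g ^ n)%g)).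
    by apply: eq_avg => n; rewrite /f1 addrC subrK.
  by rewrite avgD avg_const //; exact: 1%g.
have -> : \E_ z phi z ^+ 2 = \E_ y f0 y ^+ 2 + \E_ y \E_ x f1 y x ^+ 2.
  rewrite avg_pair [LHS]avg_exchange -avgD; apply: eq_avg => y.
  rewrite -(avg_sqr_addC 1%g _ (f1_0 y)).
  by apply: eq_avg => x; rewrite /f1 addrC subrK.
have -> : \E_ g \E_ z (conj_avg (d1 g, d2 g) phi z) ^+ 2
   = \E_ g \E_ y A0 g y ^+ 2 + \E_ g \E_ y \E_ x A1 g y x ^+ 2.
  rewrite -avgD; apply: eq_avg => g.
  rewrite avg_pair [LHS]avg_exchange -avgD; apply: eq_avg => y.
  rewrite -(avg_sqr_addC 1%g _ (A1_0 g y)).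
  by apply: eq_avg => x; rewrite splitA.
rewrite mulrDr lerD //.
  by apply: mix2; rewrite -phi0 avg_pair [RHS]avg_exchange.
pose B g y x := conj_avg (d1 g) (f1 y) x.
(* Jensen's inequality in [m] followed by translation invariance in [y] removes [d2], leaving [mix1]
   for each fixed [y]. *)
apply: (@le_trans _ _ (\E_ g \E_ y \E_ x B g y x ^+ 2)).
  apply: le_avg => g; rewrite [leLHS]avg_exchange [leRHS]avg_exchange.
  apply: le_avg => x.
  apply: (@le_trans _ _ (\E_ y \E_ m (B g (y * d2 g ^ m)%g x) ^+ 2)).
    by apply: le_avg => y; apply: sqr_avg_le.
  rewrite [leLHS]avg_exchange le_eqVlt; apply/orP; left; apply/eqP.
  transitivity (\E_ (m : N2) \E_ y (B g y x) ^+ 2).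
    by apply: eq_avg => m; rewrite -(avg_mulr (fun y => B g y x ^+ 2)).
  by rewrite avg_const //; exact: 1%g.
rewrite [leLHS]avg_exchange -avgZl; apply: le_avg => y.
exact: mix1.
Qed.

Lemma conj_mixing_form (G N : finGroupType) (delta : G -> N) (nu : R)
    (phi : N -> R) :
  0 <= nu -> conj_mixing delta (nu ^+ 2) -> avg phi = 0 ->
  \E_ g \E_ z (phi z * conj_avg (delta g) phi z) <= nu * \E_ z phi z ^+ 2.
Proof.
move=> nu_ge0 mix phi0; set V := \E_ z phi z ^+ 2.
have V_ge0 : 0 <= V by apply: avg_ge0 => z; apply: sqr_ge0.
apply: ler_of_sqr; first by rewrite mulr_ge0.
rewrite -(avg_pair (fun p => phi p.2 * conj_avg (delta p.1) phi p.2)).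
apply: le_trans (avg_CauchySchwarz _ _) _; rewrite !avg_pair /=.
rewrite (avg_const 1%g) -/V exprMn mulrC [V ^+ 2]expr2 mulrA.
by rewrite ler_wpM2r // mix.
Qed.

(* The average of [F] over right translations by [(delta g, delta h)], followed
   by the average over the diagonal of [N * N], is a function of [z = y x^-1]
   only; it has small variance. *)
Lemma diag_proj_mean0 (G N : finGroupType) (delta : G -> N) (nu : R)
    (F : N -> N -> R) :
  {morph delta : g h / (g * h)%g} -> 0 <= nu -> conj_mixing delta (nu ^+ 2) ->
  \E_ x \E_ y F x y = 0 ->
  \E_ z (\E_ x \E_ g \E_ h F (x * delta g)%g (z * (x * delta h))%g) ^+ 2
    <= nu * \E_ x \E_ y F x y ^+ 2.
Proof.
move=> deltaM nu_ge0 mix F0.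
have delta1 : delta 1%g = 1%g.
  by apply: (mulgI (delta 1%g)); rewrite -deltaM !mulg1.
have deltaV g : delta g^-1%g = (delta g)^-1%g.
  by apply: (mulgI (delta g)); rewrite -deltaM !mulgV.
pose phi z := \E_ x \E_ g \E_ h F (x * delta g)%g (z * (x * delta h))%g.
rewrite -/(phi _); set V := \E_ z phi z ^+ 2; set W := \E_ x \E_ y F x y ^+ 2.
have V_ge0 : 0 <= V by apply: avg_ge0 => z; apply: sqr_ge0.
have phi0 : avg phi = 0.
  rewrite /phi -[RHS]F0 [LHS]avg_exchange.
  transitivity (\E_ x \E_ (g : G) \E_ (h : G) \E_ y F (x * delta g)%g y).
    apply: eq_avg => x; rewrite [LHS]avg_exchange; apply: eq_avg => g.
    rewrite [LHS]avg_exchange; apply: eq_avg => h.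
    by rewrite [RHS](avg_mulr _ (x * delta h)%g).
  rewrite [LHS]avg_exchange; transitivity (\E_ (g : G) \E_ x \E_ y F x y).
    apply: eq_avg => g; rewrite [RHS](avg_mulr _ (delta g)).
    by apply: eq_avg => x; rewrite (avg_const 1%g).
  by rewrite (avg_const 1%g).
(* [Psi] is the adjoint of [F |-> phi] applied to [phi], so [V] becomes the inner product of [F]
   with [Psi]. *)
pose Psi x y := \E_ g phi (y * (x * delta g)^-1)%g.
have VE : V = \E_ x \E_ y (F x y * Psi x y).
  transitivity (\E_ z \E_ x \E_ g \E_ h
      (phi z * F (x * delta g)%g (z * (x * delta h))%g)).
    apply: eq_avg => z; rewrite expr2 {2}/phi -avgZl; apply: eq_avg => x.
    by rewrite -avgZl; apply: eq_avg => g; rewrite -avgZl.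
  transitivity (\E_ x \E_ (g : G) \E_ h \E_ z
      (phi z * F x (z * (x * delta (g^-1 * h)))%g)).
    rewrite [LHS]avg_exchange.
    under eq_avg => x do rewrite avg_exchange.
    rewrite [LHS]avg_exchange [RHS]avg_exchange; apply: eq_avg => g.
    rewrite [RHS](avg_mulr _ (delta g)); apply: eq_avg => x.
    rewrite [LHS]avg_exchange; apply: eq_avg => h; apply: eq_avg => z.
    by rewrite deltaM deltaV -!mulgA mulKVg.
  transitivity (\E_ x \E_ (g : G) \E_ y (F x y * Psi x y)).
    apply: eq_avg => x; apply: eq_avg => g.
    transitivity (\E_ h \E_ y (F x y * phi (y * (x * delta (g^-1 * h))^-1)%g)).
      apply: eq_avg => h.
      rewrite [LHS](avg_mulr _ (x * delta (g^-1 * h))^-1%g); apply: eq_avg => y.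
      by rewrite mulgKV mulrC.
    rewrite [LHS]avg_exchange; apply: eq_avg => y; rewrite avgZl; congr (_ * _).
    by rewrite [RHS](avg_mull _ g^-1%g).
  by apply: eq_avg => x; rewrite (avg_const 1%g).
(* The two shifts in the square of [Psi] differ by [x * delta (g * h^-1) * x^-1], a random conjugate
   of a random [delta g]; this is where mixing enters. *)
have PsiE : \E_ x \E_ y Psi x y ^+ 2
          = \E_ g \E_ z (phi z * conj_avg (delta g) phi z).
  transitivity (\E_ x \E_ (g : G) \E_ h \E_ z
      (phi z * phi (z * delta (g * h^-1) ^ x^-1)%g)).
    apply: eq_avg => x.
    transitivity (\E_ y \E_ g \E_ h (phi (y * (x * delta g)^-1)%g
                                * phi (y * (x * delta h)^-1)%g)).
      apply: eq_avg => y; rewrite expr2 {1}/Psi -avgZr; apply: eq_avg => g.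
      by rewrite -avgZl.
    rewrite [LHS]avg_exchange; apply: eq_avg => g.
    rewrite [LHS]avg_exchange; apply: eq_avg => h.
    rewrite [LHS](avg_mulr _ (x * delta g)%g); apply: eq_avg => z.
    rewrite mulgK; congr (_ * phi _).
    by rewrite deltaM deltaV conjgE invgK !invMg !mulgA.
  transitivity (\E_ x \E_ (g : G) \E_ h \E_ z (phi z * phi (z * delta h ^ x^-1)%g)).
    apply: eq_avg => x; apply: eq_avg => g.
    by rewrite [RHS](avg_mull _ g) [RHS]avg_inv /=; apply: eq_avg => h.
  rewrite [LHS]avg_inv.
  transitivity (\E_ x \E_ h \E_ z (phi z * phi (z * delta h ^ x)%g)).
    by apply: eq_avg => x; rewrite (avg_const 1%g) invgK.
  rewrite [LHS]avg_exchange; apply: eq_avg => h; rewrite [LHS]avg_exchange.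
  by apply: eq_avg => z; rewrite avgZl.
have le_Psi : \E_ x \E_ y Psi x y ^+ 2 <= nu * V.
  by rewrite PsiE conj_mixing_form.
have W_ge0 : 0 <= W by apply: avg_ge0 => x; apply: avg_ge0 => y; apply: sqr_ge0.
(* The bound on [Psi] is itself linear in [V], so one factor [V] cancels and [nu] survives to the
   first power. *)
have V2_le : V ^+ 2 <= W * (nu * V).
  rewrite {1}VE -(avg_pair (fun p => F p.1 p.2 * Psi p.1 p.2)).
  apply: le_trans (avg_CauchySchwarz _ _) _; rewrite !avg_pair /=.
  exact: ler_wpM2l.
have [->|V_neq0] := eqVneq V 0; first by rewrite mulr_ge0.
have V_gt0 : 0 < V by rewrite lt_def V_neq0.
by rewrite -(ler_pM2r V_gt0) -expr2 (le_trans V2_le) // mulrCA mulrA.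
Qed.

(** Constants are fixed by the averaging, so subtracting the mean [c] leaves the mean-zero case; the
    right side is [c ^+ 2] plus [nu] times the variance. *)
Lemma diag_proj_le (G N : finGroupType) (delta : G -> N) (nu : R)
    (F : N -> N -> R) :
  {morph delta : g h / (g * h)%g} -> 0 <= nu -> conj_mixing delta (nu ^+ 2) ->
  \E_ z (\E_ x \E_ g \E_ h F (x * delta g)%g (z * (x * delta h))%g) ^+ 2
    <= (1 - nu) * (\E_ x \E_ y F x y) ^+ 2 + nu * \E_ x \E_ y F x y ^+ 2.
Proof.
move=> deltaM nu_ge0 mix; set c := \E_ x \E_ y F x y.
pose F1 x y := F x y - c.
have F1_0 : \E_ x \E_ y F1 x y = 0.
  under eq_avg => x do rewrite /F1 avgB (avg_const 1%g).
  by rewrite avgB (avg_const 1%g) subrr.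
have FF : \E_ x \E_ y F x y ^+ 2 = c ^+ 2 + \E_ x \E_ y F1 x y ^+ 2.
  rewrite -!(avg_pair (fun p => F p.1 p.2 ^+ 2)).
  rewrite -!(avg_pair (fun p => F1 p.1 p.2 ^+ 2)).
  rewrite -(avg_sqr_addC 1%g); last by rewrite -F1_0 avg_pair.
  by apply: eq_avg => x; rewrite /F1 addrC subrK.
have main := diag_proj_mean0 deltaM nu_ge0 mix F1_0.
pose phi z := \E_ x \E_ g \E_ h F1 (x * delta g)%g (z * (x * delta h))%g.
have phiE z : \E_ x \E_ g \E_ h F (x * delta g)%g (z * (x * delta h))%g
            = c + phi z.
  rewrite /phi -[c](avg_const (1%g : N)) -avgD; apply: eq_avg => x.
  rewrite -[c](avg_const (1%g : G)) -avgD; apply: eq_avg => g.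
  rewrite -[c](avg_const (1%g : G)) -avgD; apply: eq_avg => h.
  by rewrite /F1 addrC subrK.
under eq_avg => z do rewrite phiE.
have phi0 : avg phi = 0.
  rewrite -[RHS]F1_0 [LHS]avg_exchange.
  transitivity (\E_ x \E_ (g : G) \E_ (h : G) \E_ y F1 (x * delta g)%g y).
    apply: eq_avg => x; rewrite [LHS]avg_exchange; apply: eq_avg => g.
    rewrite [LHS]avg_exchange; apply: eq_avg => h.
    by rewrite [RHS](avg_mulr _ (x * delta h)%g).
  rewrite [LHS]avg_exchange; transitivity (\E_ (g : G) \E_ x \E_ y F1 x y).
    apply: eq_avg => g; rewrite [RHS](avg_mulr _ (delta g)).
    by apply: eq_avg => x; rewrite (avg_const 1%g).
  by rewrite (avg_const 1%g).
rewrite (avg_sqr_addC 1%g _ phi0) FF.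
have -> : (1 - nu) * c ^+ 2 + nu * (c ^+ 2 + \E_ x \E_ y F1 x y ^+ 2)
        = c ^+ 2 + nu * \E_ x \E_ y F1 x y ^+ 2 by ring.
by rewrite lerD2l.
Qed.

End Mixing.

(** * Contraction by random words *)

Section Contraction.
Variable R : realFieldType.

Definition word_avg (N : finGroupType) (I : finType) (s : I -> N)
  (Phi : N -> R) (x : N) : R := \E_ w Phi (x * s w)%g.

(** The right side is the squared mean plus [r] times the variance. Keeping the mean explicit lets
    the inequality be averaged over a parameter on which the mean depends. *)
Definition contracting (N : finGroupType) (I : finType) (s : I -> N) (r : R) :=
  forall Phi : N -> R,
  \E_ x (word_avg s Phi x) ^+ 2
    <= (1 - r) * (avg Phi) ^+ 2 + r * \E_ x Phi x ^+ 2.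

(** In coordinates [(x, z * x)] the diagonal right factor [s w] leaves [z] fixed, so the contraction
    of [s] applies for each [z]. The squared means over [x] are then controlled by [diag_proj_le],
    and the gaps multiply: [(1 - r) * nu + r = 1 - (1 - nu) * (1 - r)]. *)
Lemma contracting_step (G N : finGroupType) (delta : G -> N) (nu r : R)
    (I : finType) (s : I -> N) :
  {morph delta : g h / (g * h)%g} -> 0 <= nu -> conj_mixing delta (nu ^+ 2) ->
  0 <= r <= 1 -> contracting s r ->
  contracting (fun w : G * G * I =>
      (s w.2 * delta w.1.1, s w.2 * delta w.1.2)%g)
    (1 - (1 - nu) * (1 - r)).
Proof.
move=> deltaM nu_ge0 mix /andP[r_ge0 r_le1] contr F.
pose F1 x y := \E_ g \E_ h F (x * delta g, y * delta h)%g.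
pose Phi z x := F1 x (z * x)%g.
have wordE z x : word_avg (fun w : G * G * I =>
      (s w.2 * delta w.1.1, s w.2 * delta w.1.2)%g) F (x, z * x)%g
    = word_avg s (Phi z) x.
  rewrite /word_avg avg_pair avg_exchange; apply: eq_avg => w.
  rewrite avg_pair; apply: eq_avg => g; apply: eq_avg => h /=.
  by congr (F _); congr pair; rewrite !mulgA.
have reparam (H : N -> N -> R) :
    \E_ x \E_ y H x y = \E_ z \E_ x H x (z * x)%g.
  rewrite [RHS]avg_exchange; apply: eq_avg => x.
  by rewrite [LHS](avg_mulr _ x).
rewrite !avg_pair [leLHS]reparam.
have -> : \E_ z \E_ x (word_avg (fun w : G * G * I =>
      (s w.2 * delta w.1.1, s w.2 * delta w.1.2)%g) F (x, z * x)%g) ^+ 2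
    = \E_ z \E_ x word_avg s (Phi z) x ^+ 2.
  by apply: eq_avg => z; apply: eq_avg => x; rewrite wordE.
apply: (@le_trans _ _ (\E_ z ((1 - r) * avg (Phi z) ^+ 2
                               + r * \E_ x Phi z x ^+ 2))).
  by apply: le_avg => z; apply: contr.
rewrite avgD !avgZl.
have -> : \E_ z avg (Phi z) ^+ 2 =
    \E_ z (\E_ x \E_ g \E_ h F (x * delta g, z * (x * delta h))%g) ^+ 2.
  apply: eq_avg => z; congr (_ ^+ 2); apply: eq_avg => x.
  by apply: eq_avg => g; apply: eq_avg => h; rewrite !mulgA.
have le1 := diag_proj_le (fun x y => F (x, y)) deltaM nu_ge0 mix.
have le2 : \E_ z \E_ x Phi z x ^+ 2 <= \E_ x \E_ y F (x, y) ^+ 2.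
  rewrite -(reparam (fun x y => F1 x y ^+ 2)).
  apply: (@le_trans _ _ (\E_ x \E_ y \E_ g \E_ h
                            F (x * delta g, y * delta h)%g ^+ 2)).
    apply: le_avg => x; apply: le_avg => y; apply: le_trans (sqr_avg_le _) _.
    by apply: le_avg => g; apply: sqr_avg_le.
  rewrite le_eqVlt; apply/orP; left; apply/eqP.
  transitivity (\E_ x \E_ (g : G) \E_ y F (x * delta g, y)%g ^+ 2).
    apply: eq_avg => x; rewrite [LHS]avg_exchange; apply: eq_avg => g.
    rewrite [LHS]avg_exchange -[RHS](avg_const (1%g : G)); apply: eq_avg => h.
    by rewrite [RHS](avg_mulr _ (delta h)).
  rewrite [LHS]avg_exchange -[RHS](avg_const (1%g : G)); apply: eq_avg => g.
  by rewrite [RHS](avg_mulr _ (delta g)).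
apply: le_trans (lerD (ler_wpM2l _ le1) (ler_wpM2l r_ge0 le2)) _.
  by rewrite subr_ge0.
by rewrite le_eqVlt; apply/orP; left; apply/eqP; ring.
Qed.

Lemma contracting_iter (N : finGroupType) (I : finType) (s : I -> N) (r : R)
    (Phi : N -> R) t :
  0 <= r -> contracting s r -> avg Phi = 0 ->
  \E_ x (\E_ (w : {ffun 'I_t -> I}) Phi (x * \prod_(j < t) s (w j))%g) ^+ 2
    <= r ^+ t * \E_ x Phi x ^+ 2.
Proof.
move=> r_ge0 contr Phi0; elim: t => [|t IHt].
  rewrite expr0 mul1r le_eqVlt; apply/orP; left; apply/eqP.
  apply: eq_avg => x; congr (_ ^+ 2).
  rewrite -[RHS](avg_const [ffun i : 'I_0 => match (notF (ltn_ord i)) with end : I]).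
  by apply: eq_avg => w; rewrite big_ord0 mulg1.
set Psi := fun y => \E_ (w : {ffun 'I_t -> I}) Phi (y * \prod_(j < t) s (w j))%g.
have Psi0 : avg Psi = 0.
  rewrite avg_exchange -[RHS](@avg0 R {ffun 'I_t -> I}); apply: eq_avg => w.
  by rewrite -[RHS]Phi0 [RHS](avg_mulr _ (\prod_(j < t) s (w j))%g).
have := contr Psi; rewrite Psi0 expr0n mulr0 add0r => le1.
rewrite exprS -mulrA; apply: le_trans (ler_wpM2l r_ge0 IHt).
apply: le_trans le1; rewrite le_eqVlt; apply/orP; left; apply/eqP.
apply: eq_avg => x; congr (_ ^+ 2); rewrite avg_ffun_cons.
apply: eq_avg => w0; apply: eq_avg => w.
rewrite big_ord_recl ffunE unlift_none /= mulgA; congr (Phi (_ * _)%g).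
by apply: eq_bigr => j _; rewrite ffunE liftK.
Qed.

End Contraction.

(** * Powers of the group indexed by the Boolean cube *)

Section Cube.
Variable gT : finGroupType.

(** The group [gT ^ {0,1}^k], built by doubling so that [conj_mixing_pair] and [contracting_step]
    apply along the induction on [k]. *)
Fixpoint cube (k : nat) : finGroupType :=
  if k is k'.+1 then (cube k' * cube k')%type : finGroupType else gT.

Fixpoint diag (k : nat) : gT -> cube k :=
  if k is k'.+1 then fun g => (diag k' g, diag k' g) else id.

Lemma diagM k : {morph diag k : g h / (g * h)%g}.
Proof. by elim: k => [|k IHk] g h //=; rewrite IHk. Qed.

Lemma diag1 k : diag k 1%g = 1%g.
Proof. by elim: k => [|k IHk] //=; rewrite IHk. Qed.

Lemma card_cube k : #|cube k| = (#|gT| ^ 2 ^ k)%N.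
Proof.
by elim: k => [|k IHk] //=; rewrite card_prod IHk -expnD addnn -mul2n expnS.
Qed.

Fixpoint cubeI (k : nat) : finType :=
  if k is k'.+1 then (gT * gT * cubeI k')%type : finType else (unit : finType).

(* The random element [(u_1^e_1 ... u_k^e_k)_e] of [gT ^ {0,1}^k]. *)
Fixpoint sel (k : nat) : cubeI k -> cube k :=
  if k is k'.+1 then
    fun w => (sel w.2 * diag k' w.1.1, sel w.2 * diag k' w.1.2)%g
  else fun _ => 1%g.

Variable R : realFieldType.

Fixpoint tens (m : gT -> R) (k : nat) : cube k -> R :=
  if k is k'.+1 then fun x => @tens m k' x.1 * @tens m k' x.2 else m.

Lemma avg_tens m k : avg (@tens m k) = avg m ^+ (2 ^ k).
Proof.
elim: k => [|k IHk] //=; rewrite avg_pair /=.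
under eq_avg => x do rewrite avgZl.
by rewrite avgZr IHk -exprD addnn -mul2n expnS.
Qed.

Lemma avg_tens_sqr m k : \E_ x @tens m k x ^+ 2 = (\E_ x m x ^+ 2) ^+ (2 ^ k).
Proof.
rewrite -[RHS]avg_tens; apply: eq_avg.
by elim: k => [|k IHk] //= x; rewrite exprMn !IHk.
Qed.

Lemma conj_mixing_cube r k :
  conj_mixing (id : gT -> gT) r -> conj_mixing (diag k) (r : R).
Proof. by move=> mix; elim: k => [|k IHk] //=; apply: conj_mixing_pair. Qed.

(** For one party [sel] is uniform on [gT * gT], so a single step yields the mean and [r = 0]. Each
    further party multiplies the gap [1 - r] by [1 - nu]. *)
Lemma contracting_sel (nu : R) k :
  0 <= nu <= 1 -> conj_mixing (id : gT -> gT) (nu ^+ 2) ->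
  contracting (@sel k.+1) (1 - (1 - nu) ^+ k).
Proof.
move=> /andP[nu_ge0 nu_le1] mix; elim: k => [|k IHk].
  rewrite expr0 subrr => Phi; rewrite subr0 mul1r mul0r addr0.
  suff E x : word_avg (@sel 1) Phi x = avg Phi.
    by under eq_avg => x do rewrite E; rewrite (avg_const 1%g).
  case: x => x y; rewrite /word_avg avg_pair /= [RHS]avg_pair.
  rewrite [RHS](avg_mull _ x) avg_pair; apply: eq_avg => g /=.
  rewrite [RHS](avg_mull _ y); apply: eq_avg => h.
  by rewrite (avg_const tt) /= !mul1g.
have [q_ge0 q_le1] : 0 <= (1 - nu) ^+ k /\ (1 - nu) ^+ k <= 1.
  by rewrite exprn_ge0 ?exprn_ile1 ?subr_ge0 // lerBlDr lerDl.
have -> : 1 - (1 - nu) ^+ k.+1 = 1 - (1 - nu) * (1 - (1 - (1 - nu) ^+ k)).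
  by rewrite exprS; ring.
apply: contracting_step IHk => //; first exact: diagM.
- exact: conj_mixing_cube.
- by rewrite subr_ge0 q_le1 lerBlDr lerDl.
Qed.

(** [contracting_iter] bounds an average over all starting points of the cube group. Keeping only
    the starting point [1] costs the order [#|gT| ^ (2 ^ k.+1)] of that group, which is absorbed
    into the second moment. *)
Lemma avg_sel_tens_sqr_le (nu : R) (m : gT -> R) k t :
  0 <= nu <= 1 -> conj_mixing (id : gT -> gT) (nu ^+ 2) -> avg m = 0 ->
  (\E_ (w : {ffun 'I_t -> cubeI k.+1}) tens m (\prod_(j < t) sel (w j))%g) ^+ 2
    <= (1 - (1 - nu) ^+ k) ^+ t
        * (#|gT|%:R * \E_ x m x ^+ 2) ^+ (2 ^ k.+1).
Proof.
move=> nu01 mix m0.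
have tens0 : avg (@tens m k.+1) = 0.
  by rewrite avg_tens m0 expr0n expn_eq0.
have r_ge0 : 0 <= 1 - (1 - nu) ^+ k.
  case/andP: nu01 => nu_ge0 nu_le1.
  by rewrite subr_ge0 exprn_ile1 ?subr_ge0 // lerBlDr lerDl.
have := contracting_iter t r_ge0 (contracting_sel (k := k) nu01 mix) tens0.
rewrite avg_tens_sqr => main.
have cgt0 : 0 < #|cube k.+1|%:R :> R.
  by rewrite ltr0n; apply/card_gt0P; exists 1%g.
rewrite exprMn -natrX -card_cube mulrCA.
apply: le_trans (ler_wpM2l (ltW cgt0) main).
rewrite [leRHS]mulrC [in leRHS]avgE divfK ?gt_eqF // (bigD1 1%g) //=.
have -> : \E_ (w : {ffun 'I_t -> cubeI k.+1}) tens m (\prod_(j < t) sel (w j))%g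
   = \E_ (w : {ffun 'I_t -> cubeI k.+1})
       @tens m k.+1 (1 * \prod_(j < t) sel (w j))%g.
  by apply: eq_avg => w; rewrite mul1g.
by rewrite lerDl sumr_ge0 // => x _; apply: sqr_ge0.
Qed.

End Cube.

(** * The box norm *)

Definition forget_row (X A : Type) (k t : nat) (i : 'I_k)
    (f : 'M[X]_(k, t) -> A) : Prop :=
  forall x y : 'M[X]_(k, t),
    (forall l j, l != i -> x l j = y l j) -> f x = f y.

Section Rows.
Variables (R : realFieldType) (gT : finGroupType) (t : nat).

Definition cons_row k (a : {ffun 'I_t -> gT}) (y : 'M[gT]_(k, t)) :
  'M[gT]_(k.+1, t) :=
  \matrix_(i, j) oapp (fun i' => y i' j) (a j) (unlift ord0 i).

Lemma cons_row0 k a (y : 'M_(k, t)) j : cons_row a y ord0 j = a j.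
Proof. by rewrite mxE unlift_none. Qed.

Lemma cons_rowS k a (y : 'M_(k, t)) i j : cons_row a y (lift ord0 i) j = y i j.
Proof. by rewrite mxE liftK. Qed.

Lemma avg_cons_row k (f : 'M[gT]_(k.+1, t) -> R) :
  avg f = \E_ a \E_ y f (cons_row a y).
Proof.
rewrite -[RHS](avg_pair (fun p => f (cons_row p.1 p.2))).
apply: avg_bij.
exists (fun x : 'M_(k.+1, t) =>
   ([ffun j => x ord0 j], \matrix_(i, j) x (lift ord0 i) j)) => [[a y]|x] /=.
  congr pair; first by apply/ffunP => j; rewrite ffunE cons_row0.
  by apply/matrixP => i j; rewrite mxE cons_rowS.
apply/matrixP => i j; rewrite mxE /=.
by case: unliftP => [i'|] -> /=; rewrite ?mxE ?ffunE.
Qed.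

Lemma avg_mx0 (f : 'M[gT]_(0, t) -> R) y : avg f = f y.
Proof.
transitivity (\E_ (x : 'M[gT]_(0, t)) f y); last exact: avg_const.
by apply: eq_avg => x; congr f; apply/matrixP => -[].
Qed.

Definition colprod k (x : 'M[gT]_(k, t)) (j : 'I_t) : gT :=
  (\prod_(l < k) x l j)%g.

Lemma colprod_cons k a (y : 'M[gT]_(k, t)) j :
  colprod (cons_row a y) j = (a j * colprod y j)%g.
Proof.
rewrite /colprod big_ord_recl cons_row0.
by congr (_ * _)%g; apply: eq_bigr => l _; rewrite cons_rowS.
Qed.

End Rows.

Lemma prodg_pair (N1 N2 : finGroupType) (I : finType) (r : seq I)
    (f1 : I -> N1) (f2 : I -> N2) :
  (\prod_(j <- r) (f1 j, f2 j) = (\prod_(j <- r) f1 j, \prod_(j <- r) f2 j))%g.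
Proof.
by elim: r => [|j r IHr]; rewrite ?big_nil // !big_cons IHr.
Qed.

Section Box.
Variables (R : realFieldType) (gT : finGroupType) (t : nat).
Variable m : gT -> R.

(** Of [K] rows, [i] have been doubled and are recorded in [w]; the other [k] are common to all cube
    vertices, hence enter through [diag]. The factor that forgets the next row is pulled out and
    bounded by [1], and Cauchy-Schwarz doubles that row. The equation [i + k = K] keeps the type
    [cubeI gT K] fixed during the induction. *)
Lemma box_CauchySchwarz_rec k i K :
  (i + k)%N = K ->
  forall f : {ffun 'I_t -> cubeI gT i} -> 'I_k -> 'M[gT]_(k, t) -> R,
  (forall w l x, `|f w l x| <= 1) ->
  (forall w l, forget_row l (f w l)) ->
  (\E_ (w : {ffun 'I_t -> cubeI gT i}) \E_ (x : 'M[gT]_(k, t))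
      (tens m (\prod_(j < t) (sel (w j) * diag i (colprod x j)))%g
        * \prod_(l < k) f w l x)) ^+ (2 ^ k)
   <= \E_ (w : {ffun 'I_t -> cubeI gT K}) tens m (\prod_(j < t) sel (w j))%g.
Proof.
elim: k i => [|k IHk] i eK f f_le1 f_forget.
  move: eK; rewrite addn0 => eK; subst K.
  rewrite expn0 expr1 le_eqVlt; apply/orP; left; apply/eqP; apply: eq_avg => w.
  rewrite (avg_mx0 _ (\matrix_(_, _) 1%g)) big_ord0 mulr1; congr (tens _ _).
  by apply: eq_bigr => j _; rewrite /colprod big_ord0 diag1 mulg1.
pose W (w : {ffun 'I_t -> cubeI gT i}) (x : 'M[gT]_(k.+1, t)) := tens m (\prod_(j < t) (sel (w j) * diag i (colprod x j)))%g.
pose one_row : {ffun 'I_t -> gT} := [ffun=> 1%g].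
pose A (w : {ffun 'I_t -> cubeI gT i}) (y : 'M[gT]_(k, t)) a := W w (cons_row a y) * \prod_(l < k) f w (lift ord0 l) (cons_row a y).
(* The factor [f w ord0] does not see the first row, so any dummy row may be inserted. *)
pose h (w : {ffun 'I_t -> cubeI gT i}) y := f w ord0 (cons_row one_row y).
rewrite expnS exprM.
have -> : \E_ (w : {ffun 'I_t -> cubeI gT i}) \E_ x (W w x * \prod_(l < k.+1) f w l x)
        = \E_ w \E_ y (h w y * avg (A w y)).
  apply: eq_avg => w; rewrite avg_cons_row avg_exchange; apply: eq_avg => y.
  rewrite -avgZl; apply: eq_avg => a; rewrite big_ord_recl mulrCA /A.
  congr (_ * _); apply: f_forget => l j; case: (unliftP ord0 l) => [l'|] -> //.
  by rewrite !cons_rowS.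
(* After doubling, each remaining factor is a product over both copies and still forgets its own
   row. *)
pose f' (w : {ffun 'I_t -> cubeI gT i.+1}) (l : 'I_k) (y : 'M[gT]_(k, t)) : R :=
  f [ffun j => (w j).2] (lift ord0 l) (cons_row [ffun j => (w j).1.1] y)
  * f [ffun j => (w j).2] (lift ord0 l) (cons_row [ffun j => (w j).1.2] y).
have f'_le1 w l y : `|f' w l y| <= 1.
  by rewrite normrM mulr_ile1.
have f'_forget w l : forget_row l (f' w l).
  move=> x y exy; rewrite /f'; congr (_ * _); apply: f_forget => l' j;
  case: (unliftP ord0 l') => [l''|] -> ?; rewrite ?cons_row0 // !cons_rowS exy //;
  by apply: contraNneq.
have eK' : (i.+1 + k)%N = K by rewrite addSnnS.
apply: le_trans (IHk _ eK' f' f'_le1 f'_forget).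
suff le_sqr : (\E_ w \E_ y (h w y * avg (A w y))) ^+ 2 <=
  \E_ (w : {ffun 'I_t -> cubeI gT i.+1}) \E_ (y : 'M[gT]_(k, t))
      (tens m (\prod_(j < t) (sel (w j) * diag i.+1 (colprod y j)))%g
        * \prod_(l < k) f' w l y).
  by rewrite lerXn2r ?nnegrE ?sqr_ge0 // (le_trans (sqr_ge0 _) le_sqr).
apply: le_trans (sqr_avg_le _) _.
apply: (@le_trans _ _ (\E_ w \E_ y (avg (A w y)) ^+ 2)).
  apply: le_avg => w; apply: le_trans (sqr_avg_le _) _; apply: le_avg => y.
  rewrite exprMn ler_piMl ?sqr_ge0 // -[X in X <= _]ger0_norm ?sqr_ge0 //.
  by rewrite normrX exprn_ile1 ?f_le1.
rewrite le_eqVlt; apply/orP; left; apply/eqP.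
rewrite [RHS]avg_ffun_pair [RHS]avg_exchange; apply: eq_avg => w.
rewrite avg_ffun_pair [LHS](_ : _ = \E_ a \E_ b \E_ y (A w y a * A w y b)).
  apply: eq_avg => a; apply: eq_avg => b; apply: eq_avg => y.
  have -> : \prod_l f' [ffun j => ([ffun j => (a j, b j)] j, w j)] l y
    = \prod_(l < k) f w (lift ord0 l) (cons_row a y)
      * \prod_(l < k) f w (lift ord0 l) (cons_row b y).
    rewrite -big_split; apply: eq_bigr => l _; rewrite /f'.
    by congr (f _ _ (cons_row _ _) * f _ _ (cons_row _ _)); apply/ffunP => j;
       rewrite !ffunE.
  rewrite /A mulrACA; congr (_ * _); rewrite /W.
  transitivity (tens m (k := i.+1)
     (\prod_(j < t) (sel (w j) * diag i (colprod (cons_row a y) j)),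
      \prod_(j < t) (sel (w j) * diag i (colprod (cons_row b y) j)))%g) => //.
  rewrite -prodg_pair; congr tens; apply: eq_bigr => j _.
  by rewrite !ffunE !colprod_cons !diagM !mulgA.
transitivity (\E_ y \E_ a \E_ b (A w y a * A w y b)).
  by apply: eq_avg => y; rewrite expr2 -avgZr; apply: eq_avg => a; rewrite -avgZl.
by rewrite avg_exchange; apply: eq_avg => a; rewrite avg_exchange.
Qed.

End Box.

(** * Two parties *)

Section TwoParties.
Variables (R : realFieldType) (gT : finGroupType) (nu : R).
Hypothesis nu_ge0 : 0 <= nu.
Hypothesis mix : conj_mixing (id : gT -> gT) (nu ^+ 2).

Lemma avg_eq_indicator (u v g : gT) (phi : gT -> R) :
  \E_ a ((#|gT|%:R * (u * a * v == g)%g%:R - 1) * phi a)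
    = phi (u^-1 * g * v^-1)%g - avg phi.
Proof.
transitivity (\E_ a (#|gT|%:R * ((u * a * v == g)%g%:R * phi a) - phi a)).
  by apply: eq_avg => a; ring.
rewrite avgB avgZl; congr (_ - _).
rewrite avgE mulrC divfK; last first.
  by rewrite pnatr_eq0 -lt0n; apply/card_gt0P; exists 1%g.
rewrite (bigD1 (u^-1 * g * v^-1)%g) //= big1 => [|a].
  by rewrite !mulgA mulgV mul1g mulgKV eqxx mul1r addr0.
move=> a_neq; case: eqP => [e|]; last by rewrite mul0r.
by case/eqP: a_neq; rewrite -e !mulgA mulVg mul1g mulgK.
Qed.

(** Expanding the square gives two copies [a], [c] with common [b1], [b2]. If [y] is the argument of
    [f a], then that of [f c] is [(c^-1 * a) ^ b1 * y], so averaging over [b1] is translation by a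
    random conjugate, to which Cauchy-Schwarz and [mix] apply. *)
Lemma two_columns_mean0 (f : gT -> gT -> R) (g : gT) :
  (forall a, avg (f a) = 0) ->
  \E_ b1 \E_ b2 (\E_ a f a (b1^-1 * a^-1 * g * b2^-1)%g) ^+ 2
    <= nu * \E_ a \E_ y f a y ^+ 2.
Proof.
move=> f0; set V := \E_ a \E_ y f a y ^+ 2.
pose D x (phi : gT -> R) y := \E_ b phi (x ^ b * y)%g.
have DE x phi y : D x phi y = conj_avg x phi y.
  rewrite /D /conj_avg [RHS](avg_mulr _ y); apply: eq_avg => b.
  by rewrite conjgM [in RHS]conjgE mulKVg.
have -> : \E_ b1 \E_ b2 (\E_ a f a (b1^-1 * a^-1 * g * b2^-1)%g) ^+ 2
        = \E_ x \E_ a \E_ y (f (a * x)%g y * D x (f a) y).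
  transitivity (\E_ b1 \E_ a \E_ c \E_ y
                  (f a y * f c ((c^-1 * a) ^ b1 * y)%g)).
    apply: eq_avg => b1.
    transitivity (\E_ b2 \E_ a \E_ c (f a (b1^-1 * a^-1 * g * b2^-1)%g
                              * f c (b1^-1 * c^-1 * g * b2^-1)%g)).
      apply: eq_avg => b2; rewrite expr2 -avgZr.
      by apply: eq_avg => a; rewrite -avgZl.
    rewrite [LHS]avg_exchange; apply: eq_avg => a.
    rewrite [LHS]avg_exchange; apply: eq_avg => c.
    rewrite [RHS](avg_mull _ (b1^-1 * a^-1 * g)%g) [RHS]avg_inv.
    apply: eq_avg => b2; congr (_ * f _ _).
    by rewrite conjgE !mulgA mulgK mulgK.
  transitivity (\E_ (b1 : gT) \E_ c \E_ x \E_ y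
                   (f (c * x)%g y * f c (x ^ b1 * y)%g)).
    apply: eq_avg => b1; rewrite [LHS]avg_exchange; apply: eq_avg => c.
    rewrite [LHS](avg_mull _ c); apply: eq_avg => x.
    by apply: eq_avg => y; rewrite mulKg.
  under eq_avg => b do rewrite avg_exchange.
  rewrite [LHS]avg_exchange; apply: eq_avg => x.
  rewrite [LHS]avg_exchange; apply: eq_avg => c.
  by rewrite [LHS]avg_exchange; apply: eq_avg => y; rewrite avgZl.
have V_ge0 : 0 <= V by apply: avg_ge0 => a; apply: avg_ge0 => y; apply: sqr_ge0.
apply: ler_of_sqr; first exact: mulr_ge0.
rewrite -(avg_pair (fun p => \E_ y (f (p.2 * p.1)%g y * D p.1 (f p.2) y))).
rewrite -(avg_pair (fun p => f (p.1.2 * p.1.1)%g p.2 * D p.1.1 (f p.1.2) p.2)).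
apply: le_trans (avg_CauchySchwarz _ _) _; rewrite !avg_pair /=.
have -> : \E_ x \E_ a \E_ y f (a * x)%g y ^+ 2 = V.
  rewrite -[RHS](avg_const (1%g : gT)); apply: eq_avg => x.
  by rewrite [RHS](avg_mulr _ x).
rewrite exprMn mulrC [V ^+ 2]expr2 mulrA ler_wpM2r //.
rewrite [leLHS]avg_exchange -avgZl; apply: le_avg => a.
apply: le_trans (mix (f0 a)); apply: le_avg => x; apply: le_avg => y.
by rewrite DE.
Qed.

(** The equation determines [a2], and the [- 1] subtracts the mean of [f a1]. Cauchy-Schwarz then
    discards [h], leaving the mean-zero case with variance at most [1]. *)
Lemma two_columns (f h : gT -> gT -> R) (g : gT) :
  (forall a1 a2, `|f a1 a2| <= 1) -> (forall b1 b2, `|h b1 b2| <= 1) ->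
  (\E_ b1 \E_ b2 \E_ a1 \E_ a2
     ((#|gT|%:R * (a1 * b1 * a2 * b2 == g)%g%:R - 1) * (f a1 a2 * h b1 b2)))
   ^+ 2 <= nu.
Proof.
move=> f_le1 h_le1.
have sqr_le1 (x : R) : `|x| <= 1 -> x ^+ 2 <= 1.
  by move=> x_le1; rewrite -[_ ^+ 2]ger0_norm ?sqr_ge0 // normrX exprn_ile1.
pose f1 a y := f a y - avg (f a).
pose A b1 b2 := \E_ a f1 a (b1^-1 * a^-1 * g * b2^-1)%g.
have -> : \E_ b1 \E_ b2 \E_ a1 \E_ a2
     ((#|gT|%:R * (a1 * b1 * a2 * b2 == g)%g%:R - 1) * (f a1 a2 * h b1 b2))
  = \E_ b1 \E_ b2 (h b1 b2 * A b1 b2).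
  apply: eq_avg => b1; apply: eq_avg => b2; rewrite -avgZl.
  apply: eq_avg => a1; rewrite avg_eq_indicator avgZr invMg.
  by rewrite -mulrBl mulrC.
apply: le_trans (sqr_avg_le _) _.
apply: (@le_trans _ _ (\E_ b1 \E_ b2 A b1 b2 ^+ 2)).
  apply: le_avg => b1; apply: le_trans (sqr_avg_le _) _; apply: le_avg => b2.
  by rewrite exprMn ler_piMl ?sqr_ge0 ?sqr_le1.
apply: le_trans (two_columns_mean0 g _) _.
  by move=> a; rewrite avgB (avg_const 1%g) subrr.
rewrite ler_piMr // -[leRHS](avg_const (1%g : gT)); apply: le_avg => a.
apply: (@le_trans _ _ (avg (f a) ^+ 2 + \E_ y f1 a y ^+ 2)).
  by rewrite lerDr sqr_ge0.
rewrite -(avg_sqr_addC 1%g) ?avgB ?(avg_const 1%g) ?subrr //.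
rewrite -[leRHS](avg_const (1%g : gT)); apply: le_avg => y.
by rewrite /f1 addrC subrK sqr_le1.
Qed.

Lemma two_rows t (f : 'I_2 -> 'M[gT]_(2, t.+2) -> R) (g : gT) :
  (forall l x, `|f l x| <= 1) -> (forall l, forget_row l (f l)) ->
  (\E_ x ((#|gT|%:R * ((\prod_j colprod x j)%g == g)%:R - 1)
            * \prod_l f l x)) ^+ 2 <= nu.
Proof.
move=> f_le1 f_forget.
pose mx a b : 'M[gT]_(2, t.+2) := cons_row a (cons_row b (\matrix_(_, _) 1%g)).
have mx0 a b j : mx a b ord0 j = a j by rewrite cons_row0.
have cp a b j : colprod (mx a b) j = (a j * b j)%g.
  by rewrite !colprod_cons /colprod big_ord0 mulg1.
pose one : {ffun 'I_t.+2 -> gT} := [ffun=> 1%g].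
(* With two rows, the factor forgetting row [0] depends on [b] only and the other one on [a]
   only. *)
have fa a b : f ord0 (mx a b) = f ord0 (mx one b).
  apply: f_forget => l j; case: (unliftP ord0 l) => [l'|] -> //.
  by rewrite !cons_rowS.
have fb a b : f (lift ord0 ord0) (mx a b) = f (lift ord0 ord0) (mx a one).
  apply: f_forget => l j; case: (unliftP ord0 l) => [l'|] -> //.
    by rewrite ord1 eqxx.
  by rewrite !mx0.
pose cons2 (a1 a2 : gT) (a : {ffun 'I_t -> gT}) : {ffun 'I_t.+2 -> gT} :=
  [ffun i => oapp [ffun i => oapp a a2 (unlift ord0 i)] a1 (unlift ord0 i)].
pose f' a a1 a2 := f (lift ord0 ord0) (mx (cons2 a1 a2 a) one).
pose h' b b1 b2 := f ord0 (mx one (cons2 b1 b2 b)).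
(* The product of the fixed columns beyond the first two is moved to the target. *)
pose g' (a b : {ffun 'I_t -> gT}) : gT := (g * (\prod_(j < t) (a j * b j))^-1)%g.
pose F (a b : {ffun 'I_t -> gT}) (b1 b2 a1 a2 : gT) :=
  (#|gT|%:R * (a1 * b1 * a2 * b2 == g' a b)%g%:R - 1) * (f' a a1 a2 * h' b b1 b2).
have -> : \E_ x ((#|gT|%:R * ((\prod_j colprod x j)%g == g)%:R - 1)
                   * \prod_l f l x)
   = \E_ a \E_ b \E_ b1 \E_ b2 \E_ a1 \E_ a2 F a b b1 b2 a1 a2.
  rewrite avg_cons_row.
  transitivity (\E_ a \E_ b
     ((#|gT|%:R * ((\prod_j colprod (mx a b) j)%g == g)%:R - 1)
                   * \prod_l f l (mx a b))).
    apply: eq_avg => a; rewrite avg_cons_row; apply: eq_avg => b.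
    by rewrite (avg_mx0 _ (\matrix_(_, _) 1%g)).
  rewrite avg_ffun_cons.
  transitivity (\E_ a1 \E_ a2 \E_ a \E_ b1 \E_ b2 \E_ b F a b b1 b2 a1 a2).
    apply: eq_avg => a1; rewrite avg_ffun_cons; apply: eq_avg => a2.
    apply: eq_avg => a; rewrite avg_ffun_cons; apply: eq_avg => b1.
    rewrite avg_ffun_cons; apply: eq_avg => b2; apply: eq_avg => b.
    rewrite /F !big_ord_recl big_ord0 mulr1 fa fb [h' _ _ _ * _]mulrC.
    rewrite -/(cons2 a1 a2 a) -/(cons2 b1 b2 b).
    rewrite [f' _ _ _ * _]mulrC -/(h' b b1 b2) -/(f' a a1 a2).
    congr ((_ * (_ : bool)%:R - 1) * _); rewrite /g'.
    rewrite !cp.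
    have -> : (\prod_(i < t) colprod (mx (cons2 a1 a2 a) (cons2 b1 b2 b))
                         (lift ord0 (lift ord0 i)))%g
       = (\prod_(j < t) (a j * b j))%g.
      by apply: eq_bigr => j _; rewrite cp !ffunE !liftK /= !ffunE !liftK.
    set P := (\prod_(j < t) _)%g.
    rewrite !ffunE !unlift_none !liftK /= !ffunE !unlift_none /= !mulgA.
    by apply/eqP/eqP => [<-|->]; rewrite ?mulgK ?mulgKV.
  transitivity (\E_ a \E_ a1 \E_ a2 \E_ b1 \E_ b2 \E_ b F a b b1 b2 a1 a2).
    under eq_avg => a1 do rewrite avg_exchange.
    by rewrite avg_exchange.
  apply: eq_avg => a.
  transitivity (\E_ a1 \E_ a2 \E_ b \E_ b1 \E_ b2 F a b b1 b2 a1 a2).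
    apply: eq_avg => a1; apply: eq_avg => a2.
    under eq_avg => b1 do rewrite avg_exchange.
    by rewrite avg_exchange.
  under eq_avg => a1 do rewrite avg_exchange.
  rewrite [LHS]avg_exchange; apply: eq_avg => b.
  under eq_avg => a1 do rewrite avg_exchange.
  rewrite [LHS]avg_exchange; apply: eq_avg => b1.
  under eq_avg => a1 do rewrite avg_exchange.
  by rewrite [LHS]avg_exchange.
apply: le_trans (sqr_avg_le _) _.
rewrite -[leRHS](avg_const ([ffun=> 1%g] : {ffun 'I_t -> gT})); apply: le_avg => a.
apply: le_trans (sqr_avg_le _) _.
rewrite -[leRHS](avg_const ([ffun=> 1%g] : {ffun 'I_t -> gT})); apply: le_avg => b.
by apply: two_columns => *; apply: f_le1.
Qed.

End TwoParties.

(** * Commutators and characters *)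

Section Characters.
Variables (gT : finGroupType) (G : {group gT}).

(* Schur's lemma: the class sum of [x] acts as a scalar. *)
Lemma sum_irr_mul_conj (i : Iirr G) z x : z \in G -> x \in G ->
  \sum_(y in G) 'chi_i (z * x ^ y)%g
    = #|G|%:R * 'chi_i z * 'chi_i x / 'chi_i 1%g.
Proof.
move=> Gz Gx; have /irr_reprP[rG irrG chiE] := mem_irr i.
have chi1 := irr1_gt0 i; move: chi1; rewrite {i}chiE => chi1.
case: rG irrG chi1 => n rG /= irrG chi1.
pose M := \sum_(y in G) rG (x ^ y)%g.
have : is_scalar_mx M.
  apply: (mx_abs_irr_cent_scalar (groupC irrG)).
  apply/centgmxP => g Gg; rewrite mulmx_suml mulmx_sumr.
  rewrite (reindex_inj (mulIg g^-1%g)) /=.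
  apply: eq_big => y; first by rewrite groupMr ?groupV.
  rewrite groupMr ?groupV // => Gy; rewrite -!repr_mxM ?groupJ ?groupM ?groupV //.
  by congr (rG _); rewrite conjgM [in LHS]conjgE invgK -!mulgA mulVg mulg1.
case/is_scalar_mxP => a Ma.
have trM : \tr M = #|G|%:R * cfRepr rG x.
  rewrite raddf_sum mulr_natl -sumr_const; apply: eq_bigr => y Gy.
  by rewrite -(cfunJ (cfRepr rG) x Gy) cfunE groupJ.
have -> : \sum_(y in G) cfRepr rG (z * x ^ y)%g = \tr (rG z *m M).
  rewrite mulmx_sumr raddf_sum; apply: eq_bigr => y Gy.
  by rewrite cfunE groupM ?groupJ // repr_mxM ?groupJ.
apply: (mulIf (lt0r_neq0 chi1)); rewrite divfK ?lt0r_neq0 // mulrAC -trM Ma.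
rewrite mul_mx_scalar mxtraceZ mxtrace_scalar cfRepr1 [cfRepr rG z]cfunE Gz.
by rewrite -[a *+ n]mulr_natr mulrAC.
Qed.

Definition commutator_count (w : gT) : nat :=
  #|[set p in setX G G | [~ p.1, p.2]%g == w]|.

Lemma sum_commutator_count (V : nmodType) (f : gT -> V) :
  \sum_(w in G) f w *+ commutator_count w
    = \sum_(x in G) \sum_(y in G) f [~ x, y]%g.
Proof.
rewrite pair_big /= (partition_big (fun p : gT * gT => [~ p.1, p.2]%g) (mem G)) /=.
  apply: eq_bigr => w Gw.
  rewrite (eq_bigr (fun=> f w)) => [|p /andP[_ /eqP-> //]].
  rewrite sumr_const; congr (_ *+ _); apply: eq_card => p.
  by rewrite !inE unfold_in.
by move=> p /andP[Gx Gy]; rewrite groupR.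
Qed.

Lemma commutator_count_class_fun :
  is_class_fun <<G>>%g [ffun w => (commutator_count w)%:R].
Proof.
rewrite genGid; apply: intro_class_fun => [w g Gw Gg | w notGw].
  congr _%:R; rewrite /commutator_count.
  rewrite -[RHS](card_imset _ (f := fun p : gT * gT => (p.1 ^ g, p.2 ^ g)%g)).
    apply: eq_card => -[x y]; apply/idP/imsetP.
      rewrite !inE /= => /andP[/andP[Gx Gy] /eqP Exy].
      exists (x ^ g^-1, y ^ g^-1)%g; rewrite /= ?conjgKV //.
      by rewrite !inE /= !groupJ ?groupV // -conjRg Exy conjgK eqxx.
    case=> -[x' y']; rewrite !inE /= => /andP[/andP[Gx Gy] /eqP<-] [-> ->].
    by rewrite !groupJ // conjRg eqxx.
  by move=> [x y] [x' y'] /= [/conjg_inj-> /conjg_inj->].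
apply/eqP; rewrite pnatr_eq0 cards_eq0; apply/eqP/setP => -[x y].
rewrite !inE /=; apply: contraNF notGw => /andP[/andP[Gx Gy] /eqP<-].
by rewrite groupR.
Qed.

Definition commutator_cfun : 'CF(G) := Cfun 0 commutator_count_class_fun.

(** Frobenius' formula. Since [[~ x, y] = x^-1 * x ^ y], Schur's lemma evaluates the sum over [y],
    and orthonormality of the characters the sum over [x]. *)
Lemma cfdot_commutator_irr (i : Iirr G) :
  '[commutator_cfun, 'chi_i] = #|G|%:R / 'chi_i 1%g.
Proof.
rewrite cfdotE; apply: (canLR (mulKf (neq0CG G))).
transitivity ((\sum_(w in G) 'chi_i w *+ commutator_count w)^*).
  rewrite rmorph_sum; apply: eq_bigr => w _.
  by rewrite cfunE rmorphMn mulr_natl.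
rewrite sum_commutator_count.
have -> : \sum_(x in G) \sum_(y in G) 'chi_i [~ x, y]%g
   = #|G|%:R / 'chi_i 1%g * \sum_(x in G) 'chi_i x^-1%g * 'chi_i x.
  rewrite mulr_sumr; apply: eq_bigr => x Gx.
  rewrite sum_irr_mul_conj ?groupV //; ring.
have -> : \sum_(x in G) 'chi_i x^-1%g * 'chi_i x = #|G|%:R.
  have := cfdot_irr i i; rewrite eqxx cfdotE => E.
  rewrite -[RHS]mulr1 -[X in _ * X]E mulVKf ?neq0CG //.
  by apply: eq_bigr => x Gx; rewrite mulrC char_inv ?irr_char.
rewrite rmorphM fmorph_div /= conjC_nat conj_natr ?Cnat_irr1 //.
by rewrite mulrC.
Qed.

Lemma sum_sqr_commutator_count :
  \sum_(w in G) (commutator_count w)%:R ^+ 2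
    = #|G|%:R ^+ 3 * \sum_i ('chi[G]_i 1%g) ^- 2 :> algC.
Proof.
have -> : \sum_(w in G) (commutator_count w)%:R ^+ 2
        = #|G|%:R * '[commutator_cfun] :> algC.
  rewrite cfdotE mulVKf ?neq0CG //; apply: eq_bigr => w _.
  by rewrite !cfunE conjC_nat expr2.
rewrite cfdot_sum_irr exprS -mulrA; congr (_ * _); rewrite mulr_sumr.
apply: eq_bigr => i _; rewrite cfdot_commutator_irr.
rewrite fmorph_div /= conjC_nat conj_natr ?Cnat_irr1 //.
by rewrite mulf_div -!expr2.
Qed.

(** The trivial character gives the main term. For the others
    [chi(1) ^ -2 <= 16 * chi(1) ^ 2 / e ^ 4], and the squared degrees sum to [#|G|]. Clearing
    [e ^ 4] leaves an inequality of natural numbers, which carries over from [algC] to any real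
    field. *)
Lemma sum_sqr_commutator_count_le (e : nat) :
  (forall i : Iirr G, i != 0 -> e%:R <= 2 * 'chi_i 1%g) ->
  (e ^ 4 * #|G| * \sum_(w in G) commutator_count w ^ 2
    <= e ^ 4 * #|G| ^ 4 + 16 * #|G| ^ 5)%N.
Proof.
move=> chi_ge; rewrite -(ler_nat algC) natrD !(natrX, natrM) natr_sum.
under eq_bigr => w _ do rewrite natrX.
rewrite sum_sqr_commutator_count (bigD1 0) //= irr0 cfun11 expr1n invr1.
rewrite !mulrDr mulr1.
have -> : e%:R ^+ 4 * #|G|%:R * #|G|%:R ^+ 3 = e%:R ^+ 4 * #|G|%:R ^+ 4 :> algC.
  by ring.
rewrite lerD2l; apply: (@le_trans _ _
  (#|G|%:R ^+ 4 * \sum_(i : Iirr G) 16 * 'chi_i 1%g ^+ 2)); last first.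
  rewrite -mulr_sumr irr_sum_square le_eqVlt; apply/orP; left; apply/eqP.
  by ring.
have -> : e%:R ^+ 4 * #|G|%:R * (#|G|%:R ^+ 3 *
     \sum_(i < Nirr G | i != 0) 'chi_i 1%g ^- 2)
   = #|G|%:R ^+ 4 * \sum_(i < Nirr G | i != 0) (e%:R ^+ 4 * 'chi_i 1%g ^- 2).
  by rewrite -mulr_sumr; ring.
rewrite ler_wpM2l ?exprn_ge0 ?ler0n // big_mkcond /=; apply: ler_sum => i _.
have chi1 := irr1_gt0 i.
case: ifP => [/chi_ge le_e|_]; last by rewrite mulr_ge0 ?ler0n // exprn_ge0 // ltW.
rewrite ler_pdivrMr ?exprn_gt0 //.
have -> : 16 * 'chi_i 1%g ^+ 2 * 'chi_i 1%g ^+ 2 = (2 * 'chi_i 1%g) ^+ 4 by ring.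
by rewrite lerXn2r ?nnegrE ?ler0n // mulr_ge0 ?ler0n // ltW.
Qed.

End Characters.

(** * From commutator counts to conjugation mixing *)

Section CommutatorMixing.
Variables (R : realFieldType) (gT : finGroupType).
Local Notation K := (commutator_count [group of [set: gT]]).
Local Notation L := (#|gT|%:R : R).

Let L_gt0 : 0 < L.
Proof. by rewrite ltr0n; apply/card_gt0P; exists 1%g. Qed.

(** The density of a random commutator relative to the uniform distribution, minus [1]. *)
Let kappa w : R := (K w)%:R / L - 1.

Lemma avg_commutator (f : gT -> R) :
  \E_ x \E_ y f [~ x, y]%g = \E_ w ((K w)%:R / L * f w).
Proof.
rewrite [RHS]avgE; transitivity ((\sum_x \sum_y f [~ x, y]%g) / L / L).
  rewrite avgE; congr (_ / _); rewrite mulr_suml.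
  by apply: eq_bigr => x _; rewrite avgE.
congr (_ / _).
transitivity ((\sum_(w in [set: gT]) f w *+ K w) / L).
  rewrite sum_commutator_count; congr (_ / _).
  by apply: eq_big => [x|x _]; [rewrite inE | apply: eq_bigl => y; rewrite inE].
rewrite mulr_suml; apply: eq_big => [w|w _]; first by rewrite inE.
by rewrite -[f w *+ _]mulr_natl mulrAC.
Qed.

(** Squaring produces two conjugates of [g], and [(g ^ n)^-1 * g ^ k] is distributed as a
    commutator. Because [phi] has mean zero the density may be replaced by [kappa]; Cauchy-Schwarz
    then leaves the second moment of [kappa], at most [nu ^+ 4]. *)
Lemma conj_mixing_of_commutator_count (nu : R) :
  L * \sum_w (K w)%:R ^+ 2 <= L ^+ 4 * (1 + nu ^+ 4) ->
  conj_mixing (id : gT -> gT) (nu ^+ 2).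
Proof.
move=> le_K phi phi0; set V := \E_ z phi z ^+ 2.
have V_ge0 : 0 <= V by apply: avg_ge0 => z; apply: sqr_ge0.
have -> : \E_ g \E_ z conj_avg g phi z ^+ 2
   = \E_ z \E_ w (kappa w * (phi z * phi (z * w)%g)).
  transitivity (\E_ z \E_ g \E_ n (phi z * phi (z * [~ g, n])%g)).
    transitivity (\E_ n \E_ k \E_ g \E_ z
                    (phi z * phi (z * (g ^ n)^-1 * g ^ k)%g)).
      transitivity (\E_ g \E_ n \E_ k \E_ z
                    (phi z * phi (z * (g ^ n)^-1 * g ^ k)%g)).
        apply: eq_avg => g.
        transitivity (\E_ z \E_ n \E_ k (phi (z * g ^ n)%g * phi (z * g ^ k)%g)).
          apply: eq_avg => z; rewrite /conj_avg expr2 -avgZr.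
          by apply: eq_avg => n; rewrite -avgZl.
        rewrite [LHS]avg_exchange; apply: eq_avg => n.
        rewrite [LHS]avg_exchange; apply: eq_avg => k.
        rewrite [RHS](avg_mulr _ (g ^ n)%g); apply: eq_avg => z.
        by rewrite mulgK.
      rewrite [LHS]avg_exchange; apply: eq_avg => n.
      by rewrite [LHS]avg_exchange.
    transitivity (\E_ (n : gT) \E_ k \E_ g \E_ z (phi z * phi (z * [~ g, k])%g)).
      apply: eq_avg => n; rewrite [RHS](avg_mull _ n^-1%g); apply: eq_avg => k.
      rewrite [RHS](avg_conj _ n); apply: eq_avg => g; apply: eq_avg => z.
      by rewrite commgEl -conjgM mulKVg -[in LHS]mulgA.
    rewrite (avg_const 1%g); under eq_avg => k do rewrite avg_exchange.
    rewrite [LHS]avg_exchange; apply: eq_avg => z.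
    by rewrite [LHS]avg_exchange.
  apply: eq_avg => z; under eq_avg => g do rewrite avgZl.
  rewrite avgZl (avg_commutator (fun w => phi (z * w)%g)) -avgZl.
  transitivity (\E_ w ((K w)%:R / L * (phi z * phi (z * w)%g)) - 0).
    by rewrite subr0; apply: eq_avg => w; rewrite mulrCA.
  rewrite -[X in _ - X](mulr0 (phi z)) -[X in _ - (_ * X)]phi0.
  rewrite [X in _ - (_ * X)](avg_mull _ z) -avgZl -avgB.
  by apply: eq_avg => w; rewrite /kappa mulrBl mul1r.
apply: ler_of_sqr; first by rewrite mulr_ge0 ?sqr_ge0.
rewrite -(avg_pair (fun p => kappa p.2 * (phi p.1 * phi (p.1 * p.2)%g))).
apply: le_trans (avg_CauchySchwarz _ _) _; rewrite !avg_pair /=.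
have -> : \E_ z \E_ w (phi z * phi (z * w)%g) ^+ 2 = V ^+ 2.
  rewrite [RHS]expr2 -avgZr; apply: eq_avg => z.
  under eq_avg => w do rewrite exprMn.
  by rewrite avgZl; congr (_ * _); rewrite [RHS](avg_mull _ z).
rewrite (avg_const 1%g) exprMn -exprM ler_wpM2r ?sqr_ge0 //.
have sumK : \E_ w ((K w)%:R / L) = 1.
  have := avg_commutator (fun=> 1); rewrite !(avg_const 1%g) => E; rewrite [RHS]E.
  by apply: eq_avg => w; rewrite mulr1.
have -> : \E_ w kappa w ^+ 2 = \E_ w ((K w)%:R / L) ^+ 2 - 1.
  transitivity (\E_ w (((K w)%:R / L) ^+ 2 - 2 * ((K w)%:R / L) + 1)).
    by apply: eq_avg => w; rewrite /kappa; ring.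
  by rewrite avgD avgB avgZl sumK (avg_const 1%g); ring.
rewrite lerBlDl -(ler_pM2l (exprn_gt0 4 L_gt0)); apply: le_trans le_K.
rewrite le_eqVlt; apply/orP; left; apply/eqP; rewrite avgE.
under eq_bigr => w _ do rewrite exprMn.
rewrite -mulr_suml exprVn; field.
by rewrite gt_eqF.
Qed.

End CommutatorMixing.

(** * The group SL(2, q) *)

Section SL2Group.
Variable F : finFieldType.

(* A copy of [SL2 F] that carries the group structure. *)
Definition sl2 : predArgType := SL2 F.
HB.instance Definition _ := Finite.copy sl2 (SL2 F).

Implicit Types A B C : sl2.

Fact sl2_mul_subproof A B : \det (val A *m val B) == 1.
Proof. by rewrite det_mulmx (eqP (valP A)) (eqP (valP B)) mulr1. Qed.
Definition sl2_mul A B : sl2 := Sub (val A *m val B) (sl2_mul_subproof A B).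

Fact sl2_one_subproof : \det (1%:M : 'M[F]_2) == 1.
Proof. by rewrite det1. Qed.
Definition sl2_one : sl2 := Sub (1%:M : 'M[F]_2) sl2_one_subproof.

Fact sl2_inv_subproof A : \det (invmx (val A)) == 1.
Proof. by rewrite det_inv (eqP (valP A)) invr1. Qed.
Definition sl2_inv A : sl2 := Sub (invmx (val A)) (sl2_inv_subproof A).

Fact sl2_mulA : associative sl2_mul.
Proof. by move=> A B C; apply: val_inj; rewrite /= mulmxA. Qed.
Fact sl2_mul1 : left_id sl2_one sl2_mul.
Proof. by move=> A; apply: val_inj; rewrite /= mul1mx. Qed.
Fact sl2_mulV : left_inverse sl2_one sl2_inv sl2_mul.
Proof.
move=> A; apply: val_inj; rewrite /= mulVmx // unitmxE.
by rewrite (eqP (valP A)) unitr1.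
Qed.

HB.instance Definition _ :=
  Finite_isGroup.Build sl2 sl2_mulA sl2_mul1 sl2_mulV.

Lemma val_sl2M A B : val (A * B)%g = val A *m val B. Proof. by []. Qed.

Lemma val_sl2_prod (I : Type) (r : seq I) (f : I -> sl2) :
  val (\prod_(i <- r) f i)%g = \prod_(i <- r) val (f i).
Proof. by elim: r => [|i r IHr]; rewrite ?big_nil // !big_cons -IHr. Qed.

Definition mx2 (a b c d : F) : 'M[F]_2 :=
  \matrix_(i, j) if i == ord0 then (if j == ord0 then a else b)
                 else (if j == ord0 then c else d).

Lemma det_mx2 a b c d : \det (mx2 a b c d) = a * d - b * c.
Proof.
rewrite (expand_det_row _ ord0) !big_ord_recl big_ord0 addr0 /cofactor !det_mx11.
by rewrite !mxE /= /bump /= expr0 mul1r expr1 mulN1r mulrN.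
Qed.

Lemma mx2_eta (A : 'M[F]_2) :
  A = mx2 (A ord0 ord0) (A ord0 (lift ord0 ord0))
          (A (lift ord0 ord0) ord0) (A (lift ord0 ord0) (lift ord0 ord0)).
Proof.
apply/matrixP => i j; rewrite mxE.
by case: (unliftP ord0 i) => [i'|] ->; case: (unliftP ord0 j) => [j'|] ->;
   rewrite ?ord1.
Qed.

Lemma mul_mx2 a b c d a' b' c' d' :
  mx2 a b c d *m mx2 a' b' c' d'
    = mx2 (a * a' + b * c') (a * b' + b * d')
          (c * a' + d * c') (c * b' + d * d').
Proof.
apply/matrixP => i j; rewrite !mxE !big_ord_recl big_ord0 addr0 !mxE /=.
by case: ifP => _; case: ifP.
Qed.

Lemma sl2P (A : sl2) : exists a b c d,
  val A = mx2 a b c d /\ a * d - b * c = 1.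
Proof.
case: A => A /= /eqP detA; rewrite (mx2_eta A) in detA *.
by do 4!eexists; split; first by []; rewrite det_mx2 in detA.
Qed.

Fact upper_subproof a : \det (mx2 1 a 0 1) == 1.
Proof. by rewrite det_mx2 mulr0 subr0 mulr1. Qed.
Definition upper a : sl2 := Sub (mx2 1 a 0 1) (upper_subproof a).

Fact weyl_subproof : \det (mx2 0 1 (-1) 0) == 1.
Proof. by rewrite det_mx2 mul0r mul1r opprK add0r. Qed.
Definition weyl : sl2 := Sub (mx2 0 1 (-1) 0) weyl_subproof.

Lemma upperD a b : upper (a + b) = (upper a * upper b)%g.
Proof. by apply: val_inj; rewrite val_sl2M /= mul_mx2; congr mx2; ring. Qed.

Lemma upper0 : upper 0 = 1%g.
Proof. by apply: (mulgI (upper 0)); rewrite -upperD mulg1 addr0. Qed.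

Lemma upperN a : upper (- a) = (upper a)^-1%g.
Proof. by apply: (mulgI (upper a)); rewrite -upperD mulgV subrr upper0. Qed.

Lemma upper_inj : injective upper.
Proof.
move=> a b /(congr1 val) /= /matrixP/(_ ord0 (lift ord0 ord0)).
by rewrite !mxE.
Qed.

(* [torus s] is the diagonal matrix [s, s^-1], and junk at [s = 0]. *)
Definition torus_mx (s : F) : 'M[F]_2 := if s == 0 then 1%:M else mx2 s 0 0 s^-1.
Fact torus_subproof s : \det (torus_mx s) == 1.
Proof.
rewrite /torus_mx; case: ifPn => s_neq0; first by rewrite det1.
by rewrite det_mx2 mulr0 subr0 mulfV.
Qed.
Definition torus s : sl2 := Sub (torus_mx s) (torus_subproof s).

Lemma torus_inj : {in [pred s | s != 0] &, injective torus}.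
Proof.
move=> s s'; rewrite !inE => s_neq0 s'_neq0.
move=> /(congr1 val) /=; rewrite /torus_mx (negPf s_neq0) (negPf s'_neq0).
by move=> /matrixP/(_ ord0 ord0); rewrite !mxE.
Qed.

Lemma upper_torus a s : s != 0 -> (upper a ^ (torus s)^-1)%g = upper (s ^+ 2 * a).
Proof.
move=> s_neq0; apply: (mulIg (torus s)); rewrite conjgE invgK -!mulgA mulVg mulg1.
apply: val_inj; rewrite !val_sl2M /= /torus_mx (negPf s_neq0) !mul_mx2.
by congr mx2; field.
Qed.

Definition upper_set : {set sl2} := upper @: [set: F].

Lemma upper_set_group : group_set upper_set.
Proof.
apply/group_setP; split; first by rewrite -upper0 imset_f ?inE.
move=> _ _ /imsetP[a _ ->] /imsetP[b _ ->].
by rewrite -upperD imset_f ?inE.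
Qed.
Canonical upper_group := Group upper_set_group.

Lemma upper_abelian : abelian upper_group.
Proof.
apply/centsP => _ /imsetP[a _ ->] _ /imsetP[b _ ->].
by rewrite /commute -!upperD addrC.
Qed.

Lemma torus_norm s : s != 0 -> torus s \in ('N(upper_group))%g.
Proof.
move=> s_neq0; rewrite -groupV inE; apply/subsetP => _ /imsetP[_ /imsetP[a _ ->] ->].
by rewrite upper_torus // imset_f ?inE.
Qed.

(** Conjugation by [weyl] puts the lower unipotents into [H], and every matrix with nonzero lower
    left entry is a product upper, lower, upper. *)
Lemma normal_closure_upper (H : {group sl2}) :
  ([set: sl2] \subset 'N(H))%g -> upper_group \subset H -> H :=: [set: sl2].
Proof.
move=> nH sUH; apply/eqP; rewrite eqEsubset subsetT /=.
have Hu a : upper a \in H by rewrite (subsetP sUH) ?imset_f ?inE.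
have Hl a : (upper a ^ weyl)%g \in H by rewrite memJ_norm // (subsetP nH) ?inE.
have val_l a : val (upper a ^ weyl)%g = mx2 1 0 (- a) 1.
  have: val (weyl * (upper a ^ weyl))%g = val (weyl)%g *m mx2 1 0 (- a) 1.
    rewrite conjgE mulKVg val_sl2M /= !mul_mx2.
    by congr mx2; ring.
  rewrite val_sl2M => /(can_inj (mulKmx _)) -> //.
  by rewrite unitmxE (eqP (valP weyl)) unitr1.
have main (A : sl2) a b c d :
    val A = mx2 a b c d -> a * d - b * c = 1 -> c != 0 -> A \in H.
  move=> EA det1 c_neq0.
  have -> : A = (upper ((a - 1) / c)%R * (upper (- c)%R ^ weyl)
                   * upper ((d - 1) / c)%R)%g.
    apply: val_inj; rewrite 2!val_sl2M val_l EA /= !mul_mx2.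
    have -> : b = (a * d - 1) / c by rewrite -det1; field.
    by congr mx2; field.
  by apply: groupM (Hu _); apply: groupM (Hu _) (Hl _).
apply/subsetP => A _; have [a [b [c [d [EA det1]]]]] := sl2P A.
have [c0|] := eqVneq c 0; last exact: main EA det1.
have d_neq0 : d != 0.
  apply: contra_eq_neq det1 => ->; rewrite c0 !mulr0 subr0 eq_sym.
  exact: oner_neq0.
(* When [c = 0], multiplying by this lower unipotent moves [d], which is nonzero, into the lower
   left corner. *)
rewrite -(groupMr A (Hl (-1))).
apply: (main _ (a + b) b d d) d_neq0; last by rewrite -det1 c0; ring.
by rewrite val_sl2M val_l EA mul_mx2; congr mx2; rewrite ?c0; ring.
Qed.

(** Three entries determine the matrix: [d] is recovered from [a], [b], [c] when [a] is nonzero, and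
    otherwise [b * c = - 1] recovers [c], so that [d] is recorded instead. *)
Lemma card_sl2_le : (#|sl2| <= #|F| ^ 3)%N.
Proof.
pose f (A : sl2) := (val A ord0 ord0, val A ord0 (lift ord0 ord0),
  if val A ord0 ord0 == 0 then val A (lift ord0 ord0) (lift ord0 ord0)
  else val A (lift ord0 ord0) ord0).
have f_inj : injective f.
  move=> A A'.
  have [a [b [c [d [EA det1]]]]] := sl2P A.
  have [a' [b' [c' [d' [EA' det1']]]]] := sl2P A'.
  rewrite /f EA EA' !mxE /=; case=> eqa eqb; move: det1' EA'.
  rewrite -{}eqa -{}eqb => det1' EA' e3; apply: val_inj; rewrite EA EA'.
  case: eqVneq e3 => [a0|a_neq0] e3.
    rewrite -e3; congr mx2; subst a.
    have b_neq0 : b != 0.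
      apply: contra_eq_neq det1 => ->; rewrite !mul0r subr0 eq_sym.
      exact: oner_neq0.
    by apply: (mulfI b_neq0); apply: oppr_inj; rewrite !mul0r !sub0r in det1 det1';
       rewrite det1 det1'.
  rewrite -e3; congr mx2; apply: (mulfI a_neq0); apply: (addIr (- (b * c))).
  by rewrite det1 e3 det1'.
apply: leq_trans (leq_card f f_inj) _.
by rewrite !card_prod !expnS expn0 muln1 mulnA.
Qed.

Lemma card_sl2_ge : (#|F| <= #|sl2|)%N.
Proof. exact: leq_card upper_inj. Qed.

(* A nontrivial irreducible character restricted to the unipotent subgroup has
   a nontrivial linear constituent, whose torus conjugates are pairwise
   distinct up to the sign of the torus parameter. *)
Lemma sl2_irr_degree_ge (i : Iirr [set: sl2]) :
  i != 0 -> #|F|.-1%:R <= 2 * 'chi_i 1%g :> algC.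
Proof.
move=> i_neq0; set U := upper_group; pose phi := 'Res[U] 'chi_i.
have phi_char : phi \is a character by rewrite cfRes_char ?irr_char.
have sUG : U \subset [set: sl2] by exact: subsetT.
have phi1 : phi 1%g = 'chi_i 1%g by rewrite cfResE.
have linU (j : Iirr U) : 'chi_j \is a linear_char.
  exact: (char_abelianP _ upper_abelian).
(* Otherwise the unipotent subgroup lies in the kernel of ['chi_i]; the kernel is normal, hence the
   whole group, and [i = 0]. *)
have [j j_constt j_neq0] : exists2 j, j \in irr_constt phi & j != 0.
  apply/exists_inP; apply: contraR i_neq0 => /exists_inPn all0.
  have phiE : phi = '[phi, 'chi_0] *: 'chi_0.
    rewrite {1}[phi]cfun_sum_constt; have [in0|notin0] := boolP (0 \in irr_constt phi).
      rewrite (bigD1 0) //= big1 ?addr0 // => j /andP[jc j_neq0].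
      by have := all0 j jc; rewrite j_neq0.
    rewrite big1 => [|j jc].
      by move: notin0; rewrite irr_consttE negbK => /eqP->; rewrite scale0r.
    by have := all0 j jc; rewrite negbK => /eqP j0; rewrite j0 in jc; case/negP: notin0.
  have sUker : U \subset cfker 'chi_i.
    apply/subsetP => x Ux; rewrite cfkerEirr inE -(cfResE 'chi_i sUG Ux).
    rewrite -[X in _ == X]phi1 -/phi phiE !cfunE irr0 !cfun1E Ux group1.
    exact: eqxx.
  by rewrite -subGcfker (normal_closure_upper (cfker_norm 'chi_i) sUker).
pose T := [set torus s | s in [set~ (0 : F)]].
pose S := [set conjg_Iirr j y | y in T].
have cardT : #|T| = #|F|.-1.
  rewrite card_in_imset ?cardsC1 // => s s'; rewrite !inE => s0 s'0.
  by apply: torus_inj.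
have S_constt l : l \in S -> l \in irr_constt phi.
  case/imsetP => _ /imsetP[s s_neq0 ->] ->.
  by rewrite irr_consttE conjg_IirrE cfdot_Res_conjg ?inE // -irr_consttE.
have leTS : (#|T| <= 2 * #|S|)%N.
  rewrite -sum1_card (partition_big_imset (conjg_Iirr j)) /= -/S mulnC -sum_nat_const.
  apply: leq_sum => l /imsetP[_ /imsetP[s s_neq0 ->] ->].
  rewrite sum1dep_card; apply: (@leq_trans #|[set torus s; torus (- s)]|); last first.
    by rewrite cards2; case: (_ != _).
  apply: subset_leq_card; apply/subsetP => _ /[!inE] /andP[/imsetP[s' s'_neq0 ->]].
  rewrite !inE in s_neq0 s'_neq0 * => /eqP eqj.
  have eqc a : 'chi_j (upper (s' ^+ 2 * a)) = 'chi_j (upper (s ^+ 2 * a)).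
    rewrite -!upper_torus // -!cfConjgE ?torus_norm // -!conjg_IirrE.
    by rewrite eqj.
  have [eq_sqr|neq_sqr] := eqVneq (s' ^+ 2) (s ^+ 2).
    by move/eqP: eq_sqr; rewrite eqf_sqr => /orP[] /eqP->; rewrite eqxx ?orbT.
  case/eqP: j_neq0; apply: irr_inj; rewrite irr0; apply/cfun_inP => x Ux.
  rewrite cfun1E Ux; case/imsetP: Ux => a _ ->.
  (* If the squares differ, every [a] is a difference of two parameters at which ['chi_j] takes
     equal values, which makes ['chi_j] trivial. *)
  have -> : a = s' ^+ 2 * (a / (s' ^+ 2 - s ^+ 2)) - s ^+ 2 * (a / (s' ^+ 2 - s ^+ 2)).
    by field; rewrite subr_eq0.
  rewrite upperD upperN lin_charM ?linU // ?groupV ?imset_f ?inE //.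
  rewrite lin_charV ?linU ?imset_f ?inE // eqc mulfV //.
  by rewrite lin_char_neq0 ?linU ?imset_f ?inE.
have : #|S|%:R <= 'chi_i 1%g.
  rewrite -phi1 [phi]cfun_sum_cfdot sum_cfunE -sumr_const.
  rewrite big_mkcond /=; apply: ler_sum => l _.
  rewrite cfunE; have /natrP[n nE] := Cnat_cfdot_char_irr l phi_char.
  have -> : 'chi_l 1%g = 1 by apply: lin_char1; apply: linU.
  rewrite mulr1; case: ifP => [/S_constt|_]; last by rewrite nE ler0n.
  by rewrite irr_consttE nE pnatr_eq0 -lt0n ler1n.
move=> leS; apply: (@le_trans _ _ (2 * #|S|%:R)); last by rewrite ler_pM2l ?ltr0n.
by rewrite -natrM ler_nat -cardT.
Qed.

End SL2Group.

(** * Protocols *)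

Section Discrepancy.
Variables (K : realFieldType) (gT : finGroupType).

(** Induction on the tree, carrying a cylinder intersection [f]. The indicator of a bit written by
    party [i] is absorbed into the factor [f i], which still forgets row [i]; the two branches
    account for a factor [2] per bit. *)
Lemma protocol_discrepancy (k t : nat) (w : 'M[gT]_(k, t) -> K) (eta : K) :
  0 <= eta ->
  (forall f : 'I_k -> 'M[gT]_(k, t) -> K, (forall l x, `|f l x| <= 1) ->
     (forall l, forget_row l (f l)) -> `|\E_ x (w x * \prod_l f l x)| <= eta) ->
  forall (p : protocol gT k t) (f : 'I_k -> 'M[gT]_(k, t) -> K),
    prot_NOF p -> (forall l x, `|f l x| <= 1) ->
    (forall l, forget_row l (f l)) ->
    `|\E_ x (w x * (prot_eval p x)%:R * \prod_l f l x)| <= 2 ^+ prot_cost p * eta.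
Proof.
move=> eta_ge0 cyl; elim=> [b|i s pl IHl pr IHr] f /=.
  move=> _ f_le1 f_forget; rewrite expr0 mul1r; case: b => /=.
    by under eq_avg => x do rewrite mulr1; apply: cyl.
  under eq_avg => x do rewrite mulr0 mul0r.
  by rewrite avg0 normr0.
case=> s_forget [NOFl NOFr] f_le1 f_forget.
pose fs (b : bool) l x := f l x * (if l == i then (s x == b)%:R else 1).
have fs_le1 b l x : `|fs b l x| <= 1.
  rewrite normrM mulr_ile1 //; case: ifP => _; rewrite ?normr1 //.
  by rewrite ger0_norm ?ler0n // lern1 leq_b1.
have fs_forget b l : forget_row l (fs b l).
  move=> x y exy; rewrite /fs (f_forget l x y exy); case: eqP => // eli.
  by rewrite (s_forget x y) // -eli.
have prod_fs b x : \prod_l fs b l x = (s x == b)%:R * \prod_l f l x.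
  rewrite big_split mulrC; congr (_ * _) => /=.
  rewrite (bigD1 i) //= eqxx big1 ?mulr1 // => l /negPf->.
  by [].
have -> : \E_ x (w x * (if s x then prot_eval pr x else prot_eval pl x)%:R
                   * \prod_l f l x)
  = \E_ x (w x * (prot_eval pr x)%:R * \prod_l fs true l x)
    + \E_ x (w x * (prot_eval pl x)%:R * \prod_l fs false l x).
  rewrite -avgD; apply: eq_avg => x; rewrite !prod_fs.
  by case: (s x) => /=; rewrite ?mul0r ?mul1r ?mulr0 ?addr0 ?add0r.
have le_cost q : (prot_cost q <= maxn (prot_cost pl) (prot_cost pr))%N ->
    2 ^+ prot_cost q * eta <= 2 ^+ maxn (prot_cost pl) (prot_cost pr) * eta.
  by move=> le_q; rewrite ler_wpM2r // ler_weXn2l // ler1n.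
apply: le_trans (ler_normD _ _) _; rewrite exprS -mulrA mulr2n mulrDl mul1r.
apply: lerD.
  apply: le_trans (IHr _ NOFr (fs_le1 _) (fs_forget _)) _.
  by apply: le_cost; rewrite leq_maxr.
apply: le_trans (IHl _ NOFl (fs_le1 _) (fs_forget _)) _.
by apply: le_cost; rewrite leq_maxl.
Qed.

Variable nu : K.
Hypothesis nu01 : 0 <= nu <= 1.
Hypothesis mix : conj_mixing (id : gT -> gT) (nu ^+ 2).

(** The box bound gives the power [2 ^ k.+1]; one more squaring is needed because the word average
    is controlled in mean square, whence the factor [2] in the exponent. *)
Lemma cylinder_discrepancy (k t : nat) (m : gT -> K)
    (f : 'I_k.+1 -> 'M[gT]_(k.+1, t) -> K) :
  avg m = 0 -> (forall l x, `|f l x| <= 1) -> (forall l, forget_row l (f l)) ->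
  (\E_ x (m (\prod_j colprod x j)%g * \prod_l f l x)) ^+ (2 * 2 ^ k.+1)
    <= (1 - (1 - nu) ^+ k) ^+ t * (#|gT|%:R * \E_ x m x ^+ 2) ^+ (2 ^ k.+1).
Proof.
move=> m0 f_le1 f_forget.
apply: le_trans (avg_sel_tens_sqr_le k t nu01 mix m0).
have := @box_CauchySchwarz_rec K gT t m k.+1 0 k.+1 (add0n _)
  (fun=> f) (fun=> f_le1) (fun=> f_forget).
have -> : \E_ (w : {ffun 'I_t -> cubeI gT 0}) \E_ x
     (tens m (k := 0) (\prod_(j < t) (sel (w j) * diag 0 (colprod x j)))%g
       * \prod_l f l x)
  = \E_ x (m (\prod_j colprod x j)%g * \prod_l f l x).
  rewrite -[RHS](avg_const ([ffun=> tt] : {ffun 'I_t -> cubeI gT 0})).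
  apply: eq_avg => w; apply: eq_avg => x; congr (m _ * _).
  by apply: eq_bigr => j _; rewrite /= mul1g.
set d := \E_ x (_ * _) => le_d; rewrite mulnC exprM.
have d_ge0 : 0 <= d ^+ (2 ^ k.+1) by rewrite exprn_even_ge0 // oddX.
by rewrite lerXn2r ?nnegrE // (le_trans d_ge0 le_d).
Qed.

End Discrepancy.

(** * Conditional probabilities as correlations *)

Section CondProb.
Variables (K : realFieldType) (gT : finGroupType).
Local Notation L := (#|gT|%:R : K).

(** With all entries but the top left one fixed, the product is a uniform element times a
    constant. *)
Lemma avg_colprod_eq (k t : nat) (g : gT) :
  \E_ (x : 'M[gT]_(k.+1, t.+1)) ((\prod_j colprod x j)%g == g)%:R = L^-1.
Proof.
rewrite avg_cons_row avg_ffun_cons.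
have L_gt0 : 0 < L by rewrite ltr0n; apply/card_gt0P; exists 1%g.
transitivity (\E_ a \E_ (a' : {ffun 'I_t -> gT}) \E_ (y : 'M[gT]_(k, t.+1))
  ((a * (colprod y ord0 * \prod_(j < t) (a' j * colprod y (lift ord0 j))))%g == g)%:R : K).
  apply: eq_avg => a; apply: eq_avg => a'; apply: eq_avg => y.
  congr (_ : bool)%:R; congr (_ == g); rewrite big_ord_recl mulgA.
  congr (_ * _)%g; first by rewrite colprod_cons ffunE unlift_none.
  by apply: eq_bigr => j _; rewrite colprod_cons ffunE liftK.
rewrite [LHS]avg_exchange -[RHS](avg_const ([ffun=> 1%g] : {ffun 'I_t -> gT})).
apply: eq_avg => a'.
rewrite [LHS]avg_exchange -[RHS](avg_const ((\matrix_(_, _) 1%g) : 'M[gT]_(k, t.+1))).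
apply: eq_avg => y; set v := (_ * _)%g.
apply: (mulfI (lt0r_neq0 L_gt0)); rewrite mulfV ?lt0r_neq0 //.
apply/eqP; rewrite -subr_eq0 -avgZl -[X in _ - X](avg_const (1%g : gT)) -avgB.
have := avg_eq_indicator 1%g v g (fun=> 1 : K).
rewrite (avg_const 1%g) subrr => <-; apply/eqP; apply: eq_avg => a.
by rewrite mulr1 mul1g.
Qed.

Lemma card_colprod_eq (k t : nat) (g : gT) :
  #|[set x : 'M[gT]_(k.+1, t.+1) | (\prod_j colprod x j)%g == g]|%:R
    = #|{: 'M[gT]_(k.+1, t.+1)}|%:R / L :> K.
Proof.
rewrite -(avg_colprod_eq k t g) avgE mulrC divfK.
  by rewrite -sum1_card natr_sum [LHS]big_mkcond; apply: eq_bigr => x _;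
     rewrite inE; case: eqP.
by rewrite pnatr_eq0 -lt0n; apply/card_gt0P; exists (\matrix_(_, _) 1%g).
Qed.

Lemma cond_avg (k t : nat) (P : 'M[gT]_(k.+1, t.+1) -> bool) (g : gT) :
  #|[set x | ((\prod_j colprod x j)%g == g) && P x]|%:R
    / #|[set x : 'M[gT]_(k.+1, t.+1) | (\prod_j colprod x j)%g == g]|%:R
  = \E_ x (L * ((\prod_j colprod x j)%g == g)%:R * (P x)%:R) :> K.
Proof.
have -> : #|[set x | ((\prod_j colprod x j)%g == g) && P x]|%:R
   = \sum_x (((\prod_j colprod x j)%g == g)%:R * (P x)%:R) :> K.
  rewrite -sum1_card natr_sum big_mkcond; apply: eq_bigr => x _.
  by rewrite inE -natrM mulnb; case: (_ && _).
rewrite card_colprod_eq invf_div avgE mulrA; congr (_ / _).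
by rewrite mulrC mulr_sumr; apply: eq_bigr => x _; rewrite mulrA.
Qed.

Definition target (g h x : gT) : K := L * (x == g)%:R - L * (x == h)%:R.

Lemma avg_indicator (g : gT) : \E_ x (x == g)%:R = L^-1.
Proof.
rewrite avgE (bigD1 g) //= eqxx big1 ?addr0 ?mul1r // => x /negPf->.
by [].
Qed.

Lemma avg_target g h : avg (target g h) = 0.
Proof. by rewrite avgB !avgZl !avg_indicator subrr. Qed.

Lemma avg_target_sqr_le g h : \E_ x target g h x ^+ 2 <= 2 * L.
Proof.
have L_gt0 : 0 < L by rewrite ltr0n; apply/card_gt0P; exists 1%g.
apply: (@le_trans _ _ (\E_ x (L ^+ 2 * ((x == g)%:R + (x == h)%:R)))).
  apply: le_avg => x; rewrite /target -mulrBr exprMn ler_wpM2l ?sqr_ge0 //.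
  by case: eqP => _; case: eqP => _ /=; rewrite ?subrr ?subr0 ?sub0r ?sqrrN
     ?expr0n ?expr1n ?addr0 ?add0r ?ler0n ?addr_ge0 ?ler0n.
rewrite avgZl avgD !avg_indicator le_eqVlt; apply/orP; left; apply/eqP.
by field; rewrite gt_eqF.
Qed.

End CondProb.

Lemma IZR2E : IZR 2 = 2 :> R. Proof. by rewrite IZRposE INRE. Qed.
Lemma IZR4E : IZR 4 = 4 :> R. Proof. by rewrite IZRposE INRE. Qed.
Lemma IZR16E : IZR 16 = 16 :> R. Proof. by rewrite IZRposE INRE. Qed.

Lemma sqr_sub_le (K : realFieldType) (a b v : K) :
  a ^+ 2 <= v -> b ^+ 2 <= v -> (a - b) ^+ 2 <= 4 * v.
Proof. by have := sqr_ge0 (a + b); nra. Qed.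

(** * Discrepancy bounds over SL(2, q) *)

Section SL2Bounds.
Variable F : finFieldType.
Hypothesis q_ge : Rle (pow 2 64) (INR #|F|).
Local Notation L := (INR #|SL2 F|).
Local Notation nu := (Rpower L (- (1 / 16))%coqR).

Lemma q_gt1 : (1 < #|F|)%N.
Proof.
by apply/card_gt1P; exists 0; exists 1; split=> //; rewrite eq_sym oner_neq0.
Qed.

Lemma L_ge : Rle (pow 2 64) L.
Proof.
apply: Rle_trans q_ge _; rewrite !INRE; apply/RleP.
rewrite ler_nat; exact: (card_sl2_ge F).
Qed.

Lemma L_ge1 : Rle 1 L.
Proof. exact: one_le_of_pow64_le L_ge. Qed.

Lemma nu_ge0_le1 : 0 <= nu <= 1.
Proof.
have [|nu_ge0 nu_le1] := @Rpower_neg_le1 L (1 / 16)%coqR L_ge1.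
  by apply: Rlt_le; apply: Rdiv_lt_0_compat; apply: IZR_lt.
by apply/andP; split; apply/RleP.
Qed.

(** With [e = q - 1] the degree bound leaves a relative error [16 * L / (q - 1) ^ 4] in the
    commutator count, which [degree_bound_le] puts below [nu ^+ 4]. *)
Lemma sl2_conj_mixing : conj_mixing (id : sl2 F -> sl2 F) (nu ^+ 2 : R).
Proof.
apply: conj_mixing_of_commutator_count.
have deg (i : Iirr [set: sl2 F]) := @sl2_irr_degree_ge F i.
have := @sum_sqr_commutator_count_le _ [group of [set: sl2 F]] _ deg.
rewrite cardsT -(ler_nat R) natrD !(natrX, natrM) natr_sum.
under eq_bigr => w _ do rewrite natrX.
under eq_bigl => w do rewrite inE.
have e_gt0 : 0 < #|F|.-1%:R :> R by rewrite ltr0n -subn1 subn_gt0 q_gt1.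
have : 16 * #|sl2 F|%:R <= nu ^+ 4 * #|F|.-1%:R ^+ 4 :> R.
  have := @degree_bound_le L (INR #|F|) q_ge.
  have e1 : Rle 1 L /\ Rle L (pow (INR #|F|) 3).
    split; first exact: L_ge1.
    rewrite RpowE !INRE -natrX; apply/RleP; rewrite ler_nat; exact: (card_sl2_le F).
  move=> /(_ e1) /RleP; rewrite !RpowE !RmultE RminusE IZR16E !INRE.
  by rewrite -subn1 natrB ?(ltnW q_gt1).
set e := #|F|.-1%:R in e_gt0 *; set l := #|sl2 F|%:R; set S := \sum_w _.
move=> le_l le_S; rewrite -(ler_pM2l (exprn_gt0 4 e_gt0)) mulrA.
apply: le_trans le_S _.
rewrite [leRHS](_ : _ = e ^+ 4 * l ^+ 4 + l ^+ 4 * (nu ^+ 4 * e ^+ 4)); last by ring.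
rewrite lerD2l [leLHS](_ : _ = l ^+ 4 * (16 * l)); last by ring.
by rewrite ler_wpM2l // exprn_ge0 ?ler0n.
Qed.

Variables (k t c : nat) (p : protocol (SL2 F) k.+1 t.+1).
Hypothesis p_NOF : prot_NOF p.
Hypothesis p_cost : (prot_cost p <= c)%N.
Variables g h : SL2 F.

Lemma cond_prob_sub :
  cond_prob (prot_eval p) g - cond_prob (prot_eval p) h
  = \E_ (x : 'M[sl2 F]_(k.+1, t.+1))
      (target R (g : sl2 F) (h : sl2 F) (\prod_j colprod x j)%g
        * (prot_eval p x)%:R) :> R.
Proof.
have condE (y : SL2 F) : cond_prob (prot_eval p) y =
   \E_ (x : 'M[sl2 F]_(k.+1, t.+1))
      (#|sl2 F|%:R * ((\prod_j colprod x j)%g == y :> sl2 F)%:R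
        * (prot_eval p x)%:R).
  rewrite -(cond_avg R (prot_eval p : 'M[sl2 F]_(k.+1, t.+1) -> bool) (y : sl2 F)).
  have colE (x : 'M[sl2 F]_(k.+1, t.+1)) :
      (@col_prod F k.+1 t.+1 x == val y) = ((\prod_j colprod x j)%g == y :> sl2 F).
    rewrite /col_prod -[in RHS]val_eqE val_sl2_prod; congr (_ == _).
    by apply: eq_bigr => j _; rewrite -val_sl2_prod.
  rewrite /cond_prob RdivE !INRE; congr (_%:R / _%:R).
    by apply: eq_card => x; rewrite !inE; congr (_ && _); apply: colE.
  by apply: eq_card => x; rewrite !inE; apply: colE.
rewrite !condE -avgB; apply: eq_avg => x.
by rewrite /target mulrBl.
Qed.

Lemma cond_prob_sub_le (eta : R) :
  0 <= eta ->
  (forall f : 'I_k.+1 -> 'M[sl2 F]_(k.+1, t.+1) -> R,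
     (forall l x, `|f l x| <= 1) -> (forall l, forget_row l (f l)) ->
     `|\E_ x (target R (g : sl2 F) (h : sl2 F) (\prod_j colprod x j)%g
               * \prod_l f l x)| <= eta) ->
  Rle (Rabs (Rminus (cond_prob (prot_eval p) g) (cond_prob (prot_eval p) h)))
      (Rmult (pow 2 c) eta).
Proof.
move=> eta_ge0 cyl; apply/RleP.
rewrite RabsE RminusE RmultE RpowE IZR2E cond_prob_sub.
have := @protocol_discrepancy R (sl2 F) k.+1 t.+1
  (fun x => target R (g : sl2 F) (h : sl2 F) (\prod_j colprod x j)%g) eta eta_ge0
  cyl p (fun=> fun=> 1) p_NOF.
under eq_avg => x do rewrite prodr_const expr1n mulr1.
move=> le_p; apply: (le_trans (le_p _ _)) => //.
  by move=> l x; rewrite normr1.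
by rewrite ler_wpM2r // ler_weXn2l // ler1n.
Qed.

Lemma cond_prob_box_bound (eta : R) :
  0 <= eta ->
  (1 - (1 - nu) ^+ k) ^+ t.+1 * (2 * L ^+ 2) ^+ (2 ^ k.+1)
    <= eta ^+ (2 * 2 ^ k.+1) ->
  Rle (Rabs (Rminus (cond_prob (prot_eval p) g) (cond_prob (prot_eval p) h)))
      (Rmult (pow 2 c) eta).
Proof.
move=> eta_ge0 le_eta; apply: cond_prob_sub_le => // f f_le1 f_forget.
have pow_gt0 : (0 < 2 * 2 ^ k.+1)%N by rewrite muln_gt0 expn_gt0.
rewrite -(ler_pXn2r pow_gt0) ?nnegrE // -normrX ger0_norm; last first.
  by rewrite exprn_even_ge0 // oddM.
apply: le_trans (cylinder_discrepancy nu_ge0_le1 sl2_conj_mixing _ f_le1 f_forget) _.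
  exact: avg_target.
apply: le_trans le_eta; rewrite ler_wpM2l //.
  case/andP: nu_ge0_le1 => nu_ge0 nu_le1.
  by rewrite exprn_ge0 // subr_ge0 exprn_ile1 ?subr_ge0 // lerBlDr lerDl.
have l_ge0 : 0 <= #|sl2 F|%:R :> R by rewrite ler0n.
rewrite lerXn2r ?nnegrE ?mulr_ge0 ?ler0n ?exprn_ge0 ?INRE //.
  by apply: avg_ge0 => x; apply: sqr_ge0.
by rewrite expr2 mulrCA ler_wpM2l // avg_target_sqr_le.
Qed.

End SL2Bounds.

(** [A g] and [A h] measure the deviation from uniform for each target separately, so the two [- 1]
    terms cancel in the difference; each square is at most [nu], and the difference costs a factor
    [4]. *)
Lemma cond_prob_two_rows_bound (F : finFieldType) (t c : nat)
    (p : protocol (SL2 F) 2 t.+2) (g h : SL2 F) (eta : R) :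
  Rle (pow 2 64) (INR #|F|) -> prot_NOF p -> (prot_cost p <= c)%N -> 0 <= eta ->
  4 * Rpower (INR #|SL2 F|) (- (1 / 16))%coqR <= eta ^+ 2 ->
  Rle (Rabs (Rminus (cond_prob (prot_eval p) g) (cond_prob (prot_eval p) h)))
      (Rmult (pow 2 c) eta).
Proof.
move=> q_ge p_NOF p_cost eta_ge0 le_eta.
have /andP[nu_ge0 _] := nu_ge0_le1 q_ge.
apply: cond_prob_sub_le => // f f_le1 f_forget.
have two y := @two_rows R (sl2 F) _ nu_ge0 (sl2_conj_mixing q_ge) t f y f_le1 f_forget.
rewrite -(ler_pXn2r (ltn0Sn 1)) ?nnegrE // real_normK ?num_real //.
apply: le_trans le_eta.
set A := fun y : sl2 F => \E_ (x : 'M[sl2 F]_(2, t.+2))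
  ((#|sl2 F|%:R * ((\prod_j colprod x j)%g == y)%:R - 1) * \prod_l f l x) : R.
have -> : \E_ (x : 'M[sl2 F]_(2, t.+2))
   (target R (g : sl2 F) (h : sl2 F) (\prod_j colprod x j)%g * \prod_l f l x)
   = A g - A h.
  rewrite -avgB; apply: eq_avg => x; rewrite -mulrBl /target; congr (_ * _).
  by rewrite opprB addrA subrK.
have Ag : A g ^+ 2 <= _ := two g; have Ah : A h ^+ 2 <= _ := two h.
exact: sqr_sub_le Ag Ah.
Qed.

Lemma expn_Nat_pow (n k : nat) : (n ^ k)%N = Nat.pow n k.
Proof. by elim: k => // k IHk; rewrite expnS IHk. Qed.

Local Close Scope ring_scope.

(* Real arithmetic written with Stdlib function names (Rle, Rmult, ...) since
   the %R delimiter is taken by MathComp's ring_scope. *)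
Theorem mainTheorem5 :
  exists (b : R) (q0 : nat), Rlt 0 b /\
  forall (F : finFieldType), (q0 <= #|F|)%N ->
  forall (k t c : nat), (2 <= k)%N -> (1 <= t)%N ->
  forall (p : protocol (SL2 F) k t),
    prot_NOF p -> (prot_cost p <= c)%N ->
  forall g h : SL2 F,
    (Rle (pow b (2 ^ k)) (INR t) ->
       Rle (Rabs (Rminus (cond_prob (prot_eval p) g) (cond_prob (prot_eval p) h)))
           (Rmult (pow 2 c)
                  (Rpower (INR #|SL2 F|) (Ropp (Rdiv (INR t) (pow b (2 ^ k)))))))
    /\
    (k = 2 -> (2 <= t)%N ->
       Rle (Rabs (Rminus (cond_prob (prot_eval p) g) (cond_prob (prot_eval p) h)))
           (Rmult (pow 2 c)
                  (Rpower (INR #|SL2 F|) (Ropp (Rdiv (INR t) b))))).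
Proof.
exists (IZR 65536), (2 ^ 64); split; first exact: IZR_lt.
move=> F q0 k t c k_ge2 t_ge1 p p_NOF p_cost g h.
have q_ge : Rle (pow 2 64) (INR #|F|).
  by rewrite INRE RpowE IZR2E -natrX; apply/RleP; rewrite ler_nat.
have L2 : Rle 2 (INR #|SL2 F|).
  exact: two_le_of_pow64_le (L_ge q_ge).
have pos a : (0 <= Rpower (INR #|SL2 F|) a)%R.
  by apply/RleP; left; apply: exp_pos.
split=> [t_ge|k2 t_ge2].
  case: k k_ge2 p p_NOF p_cost t_ge => // k k_ge1 p p_NOF p_cost t_ge.
  case: t t_ge1 p p_NOF p_cost t_ge => // t _ p p_NOF p_cost t_ge.
  apply: cond_prob_box_bound => //.
  have le1k : (1 <= k.+1)%coq_nat by apply/ssrnat.leP.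
  have := box_bound_le _ _ _ _ (L_ge q_ge) le1k (expn_Nat_pow 2 k.+1) t_ge.
  move=> /RleP.
  by rewrite !RpowE !RmultE !RminusE !IZR2E R1E minusE multE subn1.
subst k; case: t t_ge1 t_ge2 p p_NOF p_cost => [|[|t]] // _ _ p p_NOF p_cost.
(* Below [512] columns [t / b < 1 / 128], so the two-column saving of about [L ^ (-1/32)] suffices.
   From [512] on, the box bound decays with [t] fast enough to beat its moment factor
   [(2 * L ^ 2) ^ 4]. *)
have [t_small|t_big] := ltnP t.+2 512.
  apply: cond_prob_two_rows_bound => //.
  have lt_t : (t.+2 < 512)%coq_nat by apply/ssrnat.ltP.
  have := two_columns_bound_le _ _ (L_ge q_ge) lt_t.
  by move=> /RleP; rewrite RpowE RmultE IZR4E.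
apply: cond_prob_box_bound => //.
have le_t : (512 <= t.+2)%coq_nat by apply/ssrnat.leP.
have := box2_bound_le _ _ L2 le_t.
move=> /RleP; rewrite !RpowE !RmultE IZR2E.
(* For two parties the contraction factor [1 - (1 - nu) ^+ 1] is just [nu]. *)
by rewrite expr1 opprB addrCA subrr addr0.
Qed.
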